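(* Let $\psi\in\Psi$ and, for each $n\in\mathbb N$ (large enough that the expression is defined), let $$b_n=\left\lfloor\frac{\log\psi(\lfloor\log n\rfloor)-\log\log n}{\log 2}\right\rfloor.$$ If $\lim_{n\to\infty} b_n/(\log n)^{1/4}=0$, then $$\lim_{n\to\infty}\frac{S_n^{b_n}}{n\log n}=1\quad\lambda\text{-almost surely}.$$
   Context: Let $\lambda$ be Lebesgue measure on $[0,1)$ and $\tau:[0,1)\to[0,1)$ the doubling map $\tau(x)=2x \bmod 1$ (so $\lambda$ is $\tau$-invariant). Let $\chi:[0,1)\to\mathbb N\cup\{\infty\}$, $\chi(x)=\lfloor 1/x\rfloor$ (with $\chi(0)=\infty$). For $n\in\mathbb N$ set $a_n=\chi\circ\tau^{n-1}$ and $S_n=\sum_{k=1}^n a_k$. For $n\in\mathbb N$ and $x\in[0,1)$ let $\pi$ be a permutation of $\{1,\dots,n\}$ with $a_{\pi(1)}(x)\ge a_{\pi(2)}(x)\ge\dots\ge a_{\pi(n)}(x)$, and for $b\in\mathbb N$ define the trimmed sum $S_n^b=\sum_{k=b+1}^n a_{\pi(k)}$ (the sum with the $b$ largest terms removed). Let $\Psi=\{u:\mathbb N\to\mathbb R_{>0}: \sum_{n\ge1}1/u(n)<\infty\}$. Logarithms are natural. *)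

(* Defs.v *)
From Stdlib Require Import Reals Lra Lia ZArith Arith List.
Open Scope R_scope.

Definition rfloor (r : R) : Z := Int_part r.

Definition tau (x : R) : R := 2 * x - IZR (rfloor (2 * x)).

(* chi(x) = floor(1/x), chi(0) = infinity; N ∪ {∞} is modelled as option nat,
   None = ∞ *)
Definition chi (x : R) : option nat :=
  if Req_dec_T x 0 then None else Some (Z.to_nat (rfloor (/ x))).

Definition a (k : nat) (x : R) : option nat := chi (Nat.iter (k - 1) tau x).

Definition ext_le (u v : option nat) : bool :=
  match u, v with
  | _, None => true
  | None, Some _ => false
  | Some m, Some n => Nat.leb m n
  end.

Fixpoint ins_desc (u : option nat) (l : list (option nat)) : list (option nat) :=
  match l with
  | nil => u :: nil
  | v :: l' => if ext_le v u then u :: v :: l' else v :: ins_desc u l'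
  end.

Fixpoint sort_desc (l : list (option nat)) : list (option nat) :=
  match l with
  | nil => nil
  | u :: l' => ins_desc u (sort_desc l')
  end.

Definition ext_add (u v : option nat) : option nat :=
  match u, v with
  | Some m, Some n => Some (m + n)%nat
  | _, _ => None
  end.

Definition ext_sum (l : list (option nat)) : option nat :=
  fold_right ext_add (Some 0%nat) l.

Definition a_list (n : nat) (x : R) : list (option nat) :=
  map (fun k => a k x) (seq 1 n).

Definition trimmed_sum (n b : nat) (x : R) : option nat :=
  ext_sum (skipn b (sort_desc (a_list n x))).

Definition in_Psi (u : nat -> R) : Prop :=
  (forall n, (1 <= n)%nat -> 0 < u n) /\
  exists l, Un_cv (fun N => sum_f_R0 (fun k => / u (S k)) N) l.

Definition bseq (psi : nat -> R) (n : nat) : Z :=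
  rfloor ((ln (psi (Z.to_nat (rfloor (ln (INR n))))) - ln (ln (INR n))) / ln 2).

Definition lebesgue_null (E : R -> Prop) : Prop :=
  forall eps, 0 < eps ->
    exists lo hi : nat -> R,
      (forall k, lo k <= hi k) /\
      (forall x, E x -> exists k, lo k < x < hi k) /\
      (forall N, sum_f_R0 (fun k => hi k - lo k) N < eps).

(* real value of an element of N ∪ {∞} (∞ ↦ 0, only used once finiteness
   is asserted separately) *)
Definition ext_val (u : option nat) : R :=
  match u with Some m => INR m | None => 0 end.

Definition ext_cv (s : nat -> option nat) (c : nat -> R) (l : R) : Prop :=
  (exists N, forall n, (N <= n)%nat -> s n <> None) /\
  Un_cv (fun n => ext_val (s n) / c n) l.

(* Main.v *)
Require Import Defs.
From Stdlib Require Import Reals Lra Lia ZArith Arith List.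
From Stdlib Require Import Permutation Sorted Classical IndefiniteDescription Cantor.
Open Scope R_scope.

(** Write [x_k = tau^k x], [L = log n], and compare [a_k] with [1 / (x_k + t)] for
    [1 / t] a constant multiple of [n L^(3/4)].  The Birkhoff sum of the decreasing function
    [1 / (x + t)] has variance [O(n / t)], because the correlations decay geometrically, so
    along [n = i 2^m] Chebyshev and Borel-Cantelli give [sum ~ n log (1/t) ~ n L].  Terms
    above [n L^(3/4)] form a single run in which [x_k] doubles at each step: two separate
    runs before time [n] have probability [O(L^(-3/2))], summable in [m].  Such a run is a
    geometric progression, and trimming [b_n] terms divides its contribution by
    [2^(b_n)], which is at least of order [psi (floor L) / L]; hence it is negligible unless
    some [x_k] falls below a multiple of [1 / (n psi (floor L))], and the probabilities
    [O(1 / psi q)] of this are summable over the blocks [floor L = q].  Finally the trimmed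
    terms below [n L^(3/4)] cost at most [b_n n L^(3/4) = o(n L)]. *)

(** The exponent 3/4 balances three demands. With [1 / t] of order [n L^s], Chebyshev at scale [n L]
    costs [L^(s-2)], summable over [m] (which is of order [L]) when [s < 1]; two separate runs cost
    [L^(-2s)], which asks for [s > 1/2]; and trimming [b_n = o(L^(1/4))] terms is harmless up to
    [s = 3/4]. Setting [1 / x] to 0 below a threshold would destroy the monotonicity on which the
    correlation bound rests; [1 / (x + t)] keeps it, and rescaling [y] to [y / 2^l] only replaces
    [t] by [2^l t]. No integral is formed: [x] is replaced by its first [N] binary digits,
    expectations by averages over the [2^N] dyadic cells, and measure by the total length of
    interval covers. For every [P] the exceptional set is null, and [P] runs through a countable
    set. *)

Fixpoint rsum (n : nat) (f : nat -> R) : R :=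
  match n with O => 0 | S n' => rsum n' f + f n' end.

Lemma rsum_ext n f g : (forall k, (k < n)%nat -> f k = g k) -> rsum n f = rsum n g.
Proof.
  induction n as [|n IH]; intros H; simpl; [reflexivity|].
  rewrite IH, (H n) by (intros; try apply H; lia). reflexivity.
Qed.

Lemma rsum_le n f g : (forall k, (k < n)%nat -> f k <= g k) -> rsum n f <= rsum n g.
Proof.
  induction n as [|n IH]; intros H; simpl; [lra|].
  apply Rplus_le_compat; [apply IH; intros; apply H|apply H]; lia.
Qed.

Lemma rsum_const n c : rsum n (fun _ => c) = INR n * c.
Proof. induction n as [|n IH]; [simpl; ring|]. rewrite S_INR. simpl rsum. rewrite IH; ring. Qed.

Lemma rsum_nonneg n f : (forall k, (k < n)%nat -> 0 <= f k) -> 0 <= rsum n f.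
Proof.
  intros H. replace 0 with (rsum n (fun _ => 0)) by (rewrite rsum_const; ring).
  now apply rsum_le.
Qed.

Lemma rsum_plus n f g : rsum n (fun k => f k + g k) = rsum n f + rsum n g.
Proof. induction n as [|n IH]; simpl; [ring|]. rewrite IH; ring. Qed.

Lemma rsum_scal n c f : rsum n (fun k => c * f k) = c * rsum n f.
Proof. induction n as [|n IH]; simpl; [ring|]. rewrite IH; ring. Qed.

Lemma rsum_minus n f g : rsum n (fun k => f k - g k) = rsum n f - rsum n g.
Proof. induction n as [|n IH]; simpl; [ring|]. rewrite IH; ring. Qed.

Lemma rsum_swap m n f :
  rsum m (fun i => rsum n (fun j => f i j)) = rsum n (fun j => rsum m (fun i => f i j)).
Proof.
  induction m as [|m IH]; simpl.
  - rewrite rsum_const; ring.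
  - rewrite IH, <- rsum_plus. reflexivity.
Qed.

Lemma rsum_prod m n f g :
  rsum m f * rsum n g = rsum m (fun i => rsum n (fun j => f i * g j)).
Proof.
  induction m as [|m IH]; simpl; [ring|].
  rewrite rsum_scal, <- IH; ring.
Qed.

Lemma rsum_app m n f : rsum (m + n) f = rsum m f + rsum n (fun k => f (m + k)%nat).
Proof.
  induction n as [|n IH]; [rewrite Nat.add_0_r; simpl; ring|].
  rewrite Nat.add_succ_r. simpl. rewrite IH; ring.
Qed.

Lemma rsum_mul m n f :
  rsum (m * n) f = rsum m (fun q => rsum n (fun r => f (q * n + r)%nat)).
Proof.
  induction m as [|m IH]; [reflexivity|].
  replace (S m * n)%nat with (m * n + n)%nat by lia.
  rewrite rsum_app, IH. reflexivity.
Qed.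

Lemma rsum_mono_n m n f :
  (m <= n)%nat -> (forall k, 0 <= f k) -> rsum m f <= rsum n f.
Proof.
  intros H Hf. replace n with (m + (n - m))%nat by lia. rewrite rsum_app.
  pose proof (rsum_nonneg (n - m) (fun k => f (m + k)%nat) (fun k _ => Hf _)). lra.
Qed.

Lemma rsum_indicator n k c :
  (k < n)%nat -> rsum n (fun j => if Nat.eqb j k then c else 0) = c.
Proof.
  intros H. replace n with (k + (1 + (n - k - 1)))%nat by lia.
  rewrite !rsum_app. simpl. rewrite Nat.add_0_r, Nat.eqb_refl.
  rewrite (rsum_ext k _ (fun _ => 0)), (rsum_ext (n - k - 1) _ (fun _ => 0)).
  - rewrite !rsum_const; ring.
  - intros j _. destruct (Nat.eqb_spec (k + S j) k); [lia|reflexivity].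
  - intros j Hj. destruct (Nat.eqb_spec j k); [lia|reflexivity].
Qed.

Lemma sum_f_R0_rsum f n : sum_f_R0 f n = rsum (S n) f.
Proof. induction n as [|n IH]; [simpl; ring|]. rewrite tech5, IH. reflexivity. Qed.

(** * Outer measure *)

(** The non-strict bound makes costs exactly additive under unions; the strict one of
    [lebesgue_null] is recovered at the end by halving [eps]. *)
Definition outer_le (E : R -> Prop) (p : R) : Prop :=
  exists lo hi : nat -> R,
    (forall k, lo k <= hi k) /\
    (forall x, E x -> exists k, lo k < x < hi k) /\
    (forall N, rsum N (fun k => hi k - lo k) <= p).

Lemma outer_le_weaken (E F : R -> Prop) p q :
  (forall x, F x -> E x) -> p <= q -> outer_le E p -> outer_le F q.
Proof.
  intros HF Hpq (lo & hi & H1 & H2 & H3). exists lo, hi.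
  repeat split; auto. intros N. specialize (H3 N). lra.
Qed.

Lemma outer_le_nonneg E p : outer_le E p -> 0 <= p.
Proof. intros (lo & hi & _ & _ & H). exact (H O). Qed.

Lemma outer_le_empty (E : R -> Prop) p : (forall x, ~ E x) -> 0 <= p -> outer_le E p.
Proof.
  intros HE Hp. exists (fun _ => 0), (fun _ => 0). split; [|split].
  - intros; lra.
  - intros x Hx. now destruct (HE x).
  - intros N. rewrite rsum_const. lra.
Qed.

Lemma outer_le_interval (E : R -> Prop) c r :
  0 <= r -> (forall x, E x -> c - r < x < c + r) -> outer_le E (2 * r).
Proof.
  intros Hr HE.
  (* The sequence is padded with empty intervals [(0, 0)]. *)
  exists (fun k => if Nat.eqb k 0 then c - r else 0),
         (fun k => if Nat.eqb k 0 then c + r else 0). split; [|split].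
  - intros k; destruct (Nat.eqb k 0); lra.
  - intros x Hx. exists O. simpl. now apply HE.
  - intros N. rewrite (rsum_ext N _ (fun k => if Nat.eqb k 0 then 2 * r else 0)).
    + destruct N; [simpl; lra|]. rewrite rsum_indicator by lia. lra.
    + intros k _. destruct (Nat.eqb k 0); ring.
Qed.

#[local] Opaque to_nat of_nat.

(** The code of a pair is at least the sum of its entries, so the pairs with code below [N] all lie
    in the [N] by [N] square; since [f] is nonnegative, enlarging to the square is allowed. *)
Lemma rsum_cantor_le (f : nat -> nat -> R) (c : R) :
  (forall i j, 0 <= f i j) ->
  (forall M, rsum M (fun i => rsum M (fun j => f i j)) <= c) ->
  forall N, rsum N (fun k => f (fst (of_nat k)) (snd (of_nat k))) <= c.
Proof.
  intros Hf Hc N. apply Rle_trans with (2 := Hc N).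
  rewrite (rsum_ext N _ (fun k => rsum N (fun i => rsum N (fun j =>
    if Nat.eqb k (to_nat (i, j)) then f i j else 0)))).
  - rewrite rsum_swap. apply rsum_le. intros i _.
    rewrite rsum_swap. apply rsum_le. intros j _.
    destruct (le_lt_dec N (to_nat (i, j))) as [H|H].
    + rewrite (rsum_ext N _ (fun _ => 0)).
      * rewrite rsum_const. specialize (Hf i j). lra.
      * intros k Hk. destruct (Nat.eqb_spec k (to_nat (i, j))); [lia|reflexivity].
    + rewrite rsum_indicator by assumption. lra.
  - intros k Hk. destruct (of_nat k) as [a b] eqn:E. simpl.
    assert (Ek : k = to_nat (a, b)) by (rewrite <- E; symmetry; apply cancel_to_of).
    assert (Hab : (b + a <= k)%nat) by (rewrite Ek; apply to_nat_non_decreasing).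
    rewrite (rsum_ext N _ (fun i => if Nat.eqb i a then f a b else 0)).
    + rewrite rsum_indicator by lia. reflexivity.
    + intros i _. destruct (Nat.eqb_spec i a) as [->|Hi].
      * rewrite (rsum_ext N _ (fun j => if Nat.eqb j b then f a b else 0)).
        -- apply rsum_indicator; lia.
        -- intros j _. destruct (Nat.eqb_spec j b) as [->|Hj].
           ++ rewrite Ek, Nat.eqb_refl. reflexivity.
           ++ destruct (Nat.eqb_spec k (to_nat (a, j))) as [e|_]; [|reflexivity].
              rewrite Ek in e. apply to_nat_inj in e. congruence.
      * rewrite (rsum_ext N _ (fun _ => 0)); [rewrite rsum_const; ring|].
        intros j _. destruct (Nat.eqb_spec k (to_nat (i, j))) as [e|_]; [|reflexivity].
        rewrite Ek in e. apply to_nat_inj in e. congruence.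
Qed.

Lemma outer_le_countable_union (E : nat -> R -> Prop) (p : nat -> R) (c : R) :
  (forall m, outer_le (E m) (p m)) -> (forall N, rsum N p <= c) ->
  outer_le (fun x => exists m, E m x) c.
Proof.
  intros HE Hc.
  destruct (functional_choice
    (fun m (lh : (nat -> R) * (nat -> R)) =>
      (forall k, fst lh k <= snd lh k) /\
      (forall x, E m x -> exists k, fst lh k < x < snd lh k) /\
      (forall N, rsum N (fun k => snd lh k - fst lh k) <= p m))) as [F HF].
  { intros m. destruct (HE m) as (lo & hi & H). now exists (lo, hi). }
  exists (fun k => fst (F (fst (of_nat k))) (snd (of_nat k))),
         (fun k => snd (F (fst (of_nat k))) (snd (of_nat k))). split; [|split].
  - intros k. apply HF.
  - intros x (m & Hx). destruct (HF m) as (_ & H & _). destruct (H x Hx) as [k Hk].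
    exists (to_nat (m, k)). rewrite cancel_of_to. exact Hk.
  - apply (rsum_cantor_le (fun i j => snd (F i) j - fst (F i) j)).
    + intros i j. destruct (HF i) as (H & _). specialize (H j). lra.
    + intros M. apply Rle_trans with (2 := Hc M). apply rsum_le.
      intros i _. apply HF.
Qed.

Lemma outer_le_finite_union K (E : nat -> R -> Prop) (p : nat -> R) :
  (forall j, (j < K)%nat -> outer_le (E j) (p j)) ->
  outer_le (fun x => exists j, (j < K)%nat /\ E j x) (rsum K p).
Proof.
  intros HE.
  set (q := fun j => if Nat.ltb j K then p j else 0).
  apply (outer_le_countable_union (fun j x => (j < K)%nat /\ E j x) q).
  - intros j. unfold q. destruct (Nat.ltb_spec j K) as [H|H].
    + apply outer_le_weaken with (3 := HE j H); [tauto|lra].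
    + apply outer_le_empty; [intros x [Hx _]; lia|lra].
  - assert (Hq : forall j, 0 <= q j).
    { intros j. unfold q. destruct (Nat.ltb_spec j K) as [H|H]; [|lra].
      exact (outer_le_nonneg _ _ (HE j H)). }
    intros N. apply Rle_trans with (rsum (N + K) q).
    + apply rsum_mono_n; [lia|assumption].
    + rewrite Nat.add_comm, rsum_app.
      rewrite (rsum_ext N _ (fun _ => 0)), rsum_const.
      * rewrite (rsum_ext K q p); [lra|].
        intros k Hk. unfold q. destruct (Nat.ltb_spec k K); [reflexivity|lia].
      * intros k Hk. unfold q. destruct (Nat.ltb_spec (K + k) K); [lia|reflexivity].
Qed.

Lemma outer_le_union (E F : R -> Prop) p q :
  outer_le E p -> outer_le F q -> outer_le (fun x => E x \/ F x) (p + q).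
Proof.
  intros HE HF.
  apply outer_le_weaken with
    (E := fun x => exists j, (j < 2)%nat /\ (if Nat.eqb j 0 then E x else F x))
    (p := rsum 2 (fun j => if Nat.eqb j 0 then p else q)).
  - intros x [H|H]; [exists 0%nat|exists 1%nat]; split; auto.
  - simpl; lra.
  - apply (outer_le_finite_union 2 (fun j x => if Nat.eqb j 0 then E x else F x)).
    intros j _. now destruct (Nat.eqb j 0).
Qed.

Lemma lebesgue_null_outer E : (forall eps, 0 < eps -> outer_le E eps) -> lebesgue_null E.
Proof.
  intros H eps He. destruct (H (eps / 2)) as (lo & hi & H1 & H2 & H3); [lra|].
  exists lo, hi. repeat split; auto. intros N. rewrite sum_f_R0_rsum.
  specialize (H3 (S N)). lra.
Qed.

Definition null (E : R -> Prop) := forall eps, 0 < eps -> outer_le E eps.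

Lemma null_countable_union (E : nat -> R -> Prop) :
  (forall m, null (E m)) -> null (fun x => exists m, E m x).
Proof.
  intros H eps He.
  apply (outer_le_countable_union E (fun m => eps * (/ 2) ^ S m)).
  - intros m. apply H. apply Rmult_lt_0_compat; [lra|]. apply pow_lt; lra.
  - intros N. rewrite rsum_scal.
    assert (E1 : rsum N (fun k => (/ 2) ^ S k) = 1 - (/ 2) ^ N).
    { clear. induction N as [|N IH]; [simpl; ring|].
      change (rsum (S N) _) with (rsum N (fun k => (/ 2) ^ S k) + (/ 2) ^ S N).
      rewrite IH. simpl. field. }
    rewrite E1. assert (0 < (/ 2) ^ N) by (apply pow_lt; lra). nra.
Qed.

Lemma null_union (E F : R -> Prop) : null E -> null F -> null (fun x => E x \/ F x).
Proof.
  intros HE HF eps He. replace eps with (eps / 2 + eps / 2) by field.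
  apply outer_le_union; [apply HE|apply HF]; lra.
Qed.

(** Summability in Cauchy form: Borel-Cantelli consumes only tails, and no value of the series has
    to be named. *)
Definition small_tails (p : nat -> R) : Prop :=
  forall eps, 0 < eps ->
    exists M, forall m, (M <= m)%nat -> forall N, rsum N (fun k => p (m + k)%nat) <= eps.

Lemma borel_cantelli (E : nat -> R -> Prop) (p : nat -> R) (m0 : nat) :
  (forall m, (m0 <= m)%nat -> outer_le (E m) (p m)) -> small_tails p ->
  null (fun x => forall M, exists m, (M <= m)%nat /\ E m x).
Proof.
  intros HE Hp eps He. destruct (Hp eps He) as [M HM].
  apply outer_le_weaken with
    (E := fun x => exists k, E (M + m0 + k)%nat x) (p := eps); [|lra|].
  - intros x Hx. destruct (Hx (M + m0)%nat) as (m & Hm & Ex).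
    exists (m - (M + m0))%nat. now replace (M + m0 + (m - (M + m0)))%nat with m by lia.
  - apply (outer_le_countable_union (fun k => E (M + m0 + k)%nat)
                                    (fun k => p (M + m0 + k)%nat)).
    + intros k. apply HE. lia.
    + apply HM. lia.
Qed.

(** * The doubling map *)

Lemma INR_pow2 l : INR (2 ^ l) = 2 ^ l.
Proof. rewrite pow_INR. f_equal. Qed.

Lemma pow2_pos l : 0 < 2 ^ l.
Proof. apply pow_lt; lra. Qed.

Lemma Int_part_unique r z : IZR z <= r < IZR z + 1 -> Int_part r = z.
Proof.
  intros H. destruct (base_Int_part r) as [H1 H2].
  assert (Int_part r < z + 1)%Z by (apply lt_IZR; rewrite plus_IZR; lra).
  assert (z < Int_part r + 1)%Z by (apply lt_IZR; rewrite plus_IZR; lra).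
  lia.
Qed.

Lemma tau_range x : 0 <= tau x < 1.
Proof. unfold tau, rfloor. destruct (base_Int_part (2 * x)). lra. Qed.

Definition orb (k : nat) (x : R) : R := Nat.iter k tau x.

Lemma orb_range k x : 0 <= x < 1 -> 0 <= orb k x < 1.
Proof. intros H. destruct k as [|k]; [exact H|apply tau_range]. Qed.

Lemma orb_add k l x : orb (k + l) x = orb l (orb k x).
Proof. unfold orb. rewrite Nat.add_comm. apply Nat.iter_add. Qed.

(** The integer [j] is written by the first [k] binary digits of [x]; the remaining digits are those
    of [orb k x]. *)
Lemma orb_digits k x : 0 <= x < 1 ->
  exists j, (j < 2 ^ k)%nat /\ 2 ^ k * x = INR j + orb k x.
Proof.
  intros Hx. induction k as [|k (j & Hj & IH)].
  - exists O. split; [simpl; lia|]. unfold orb; simpl. ring.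
  - set (y := orb k x) in *.
    assert (Hy : 0 <= y < 1) by now apply orb_range.
    assert (E : orb (S k) x = 2 * y - IZR (Int_part (2 * y))) by reflexivity.
    destruct (Rlt_le_dec y (1 / 2)) as [H|H].
    + exists (2 * j)%nat. split; [simpl; lia|].
      rewrite E, (Int_part_unique _ 0) by lra.
      rewrite mult_INR. change (INR 2) with 2. simpl. nra.
    + exists (2 * j + 1)%nat. split; [simpl; lia|].
      rewrite E, (Int_part_unique _ 1) by lra.
      rewrite plus_INR, mult_INR. change (INR 2) with 2. simpl. nra.
Qed.

Lemma INR_floor_unique i j r s :
  INR i + r = INR j + s -> 0 <= r < 1 -> 0 <= s < 1 -> i = j.
Proof.
  intros E Hr Hs. assert (H1 : INR i < INR (S j)) by (rewrite S_INR; lra).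
  assert (H2 : INR j < INR (S i)) by (rewrite S_INR; lra).
  apply INR_lt in H1, H2. lia.
Qed.

Lemma orb_no_wrap k x : 0 <= x -> 2 ^ k * x < 1 -> orb k x = 2 ^ k * x.
Proof.
  intros Hx H. destruct (orb_digits k x) as (j & _ & E).
  { pose proof (pow_R1_Rle 2 k). nra. }
  assert (Hx1 : 0 <= x < 1) by (pose proof (pow_R1_Rle 2 k); nra).
  pose proof (orb_range k x Hx1). pose proof (pow2_pos k).
  assert (j = O).
  { apply (INR_floor_unique j 0 (orb k x) (2 ^ k * x)); simpl; nra. }
  subst j. simpl in E. lra.
Qed.

(** The shift drops leading digits, so the point at time [N - a] begins with the last [a] of the [N]
    digits that [j] encodes. Hence functions of the orbit become, up to discretisation, functions of
    the cell index [j]. *)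
Lemma digit_mod N a x j : 0 <= x < 1 -> (a <= N)%nat ->
  2 ^ N * x = INR j + orb N x ->
  INR (j mod 2 ^ a) <= 2 ^ a * orb (N - a) x < INR (j mod 2 ^ a) + 1.
Proof.
  intros Hx Ha E.
  destruct (orb_digits (N - a) x Hx) as (u & _ & E1).
  pose proof (orb_range (N - a) x Hx) as Hy.
  destruct (orb_digits a _ Hy) as (v & Hv & E2).
  rewrite <- orb_add in E2. replace (N - a + a)%nat with N in E2 by lia.
  pose proof (orb_range N x Hx) as Hz.
  assert (Ej : j = (v + u * 2 ^ a)%nat).
  { apply (INR_floor_unique j _ (orb N x) (orb N x)); auto.
    rewrite <- E, plus_INR, mult_INR, INR_pow2.
    replace N with (N - a + a)%nat at 1 by lia. rewrite pow_add.
    transitivity (2 ^ a * (2 ^ (N - a) * x)); [ring|]. rewrite E1. nra. }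
  rewrite Ej, Nat.Div0.mod_add, Nat.mod_small by assumption. lra.
Qed.

(** Each of the [2 ^ k] cells is covered by an interval centred at its left endpoint; the symmetric
    shape doubles the length, which only affects constants. *)
Lemma outer_le_orb_small k s : 0 <= s ->
  outer_le (fun x => 0 <= x < 1 /\ orb k x < s) (2 * s).
Proof.
  intros Hs. pose proof (pow2_pos k) as H2.
  apply outer_le_weaken with
    (E := fun x => exists j, (j < 2 ^ k)%nat /\ (0 <= x < 1 /\ orb k x < s /\
                     2 ^ k * x = INR j + orb k x))
    (p := rsum (2 ^ k) (fun _ => 2 * (s / 2 ^ k))).
  - intros x (Hx & Hy). destruct (orb_digits k x Hx) as (j & Hj & E).
    exists j; auto.
  - rewrite rsum_const, INR_pow2. apply Req_le. field. lra.
  - apply (outer_le_finite_union _ (fun j x => 0 <= x < 1 /\ orb k x < s /\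
                     2 ^ k * x = INR j + orb k x)).
    intros j _. apply outer_le_interval with (c := INR j / 2 ^ k).
    + apply Rle_mult_inv_pos; lra.
    + intros x (Hx & Hy & E). pose proof (orb_range k x Hx).
      replace x with ((INR j + orb k x) / 2 ^ k) by (rewrite <- E; field; lra).
      unfold Rdiv. rewrite <- Rmult_minus_distr_r, <- Rmult_plus_distr_r.
      assert (0 < / 2 ^ k) by now apply Rinv_0_lt_compat.
      assert (0 < s) by lra.
      split; apply Rmult_lt_compat_r; lra.
Qed.

(* Beyond a gap of M the two conditions constrain disjoint blocks of digits. *)
Lemma outer_le_orb_two_small k l M : (M <= l)%nat ->
  outer_le (fun x => 0 <= x < 1 /\ orb k x < / 2 ^ M /\ orb (k + l) x < / 2 ^ M)
           (2 * (/ 2 ^ M) ^ 2).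
Proof.
  intros HM. pose proof (pow2_pos k) as Hk. pose proof (pow2_pos l) as Hl.
  pose proof (pow2_pos M) as HM2. pose proof (pow2_pos (l - M)) as HlM.
  assert (El : 2 ^ l = 2 ^ M * 2 ^ (l - M)) by (rewrite <- pow_add; f_equal; lia).
  assert (Ei : 0 < / 2 ^ M) by now apply Rinv_0_lt_compat.
  set (c := fun u v => (INR u * 2 ^ l + INR v) / (2 ^ k * 2 ^ l)).
  set (r := / 2 ^ M / (2 ^ k * 2 ^ l)).
  assert (Hkl : 0 < / (2 ^ k * 2 ^ l)) by (apply Rinv_0_lt_compat, Rmult_lt_0_compat; lra).
  assert (Hr : 0 < r) by (apply Rmult_lt_0_compat; lra).
  apply outer_le_weaken with
    (E := fun x => exists u, (u < 2 ^ k)%nat /\ exists v, (v < 2 ^ (l - M))%nat /\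
       c u v - r < x < c u v + r)
    (p := rsum (2 ^ k) (fun _ => rsum (2 ^ (l - M)) (fun _ => 2 * r))).
  - intros x (Hx & H1 & H2).
    destruct (orb_digits k x Hx) as (u & Hu & Eu).
    pose proof (orb_range k x Hx) as Hy.
    destruct (orb_digits l _ Hy) as (v & Hv & Ev). rewrite <- orb_add in Ev.
    pose proof (orb_range (k + l) x Hx) as Hz.
    exists u; split; [assumption|]. exists v; split.
    (* The first [M] of the [l] digits of [orb k x] vanish, which leaves only [2 ^ (l - M)] values
       for [v]. *)
    + apply INR_lt. rewrite INR_pow2.
      apply Rle_lt_trans with (2 ^ l * orb k x); [lra|].
      replace (2 ^ (l - M)) with (2 ^ l * / 2 ^ M) by (rewrite El; field; lra).
      apply Rmult_lt_compat_l; lra.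
    + replace x with ((INR u * 2 ^ l + INR v + orb (k + l) x) / (2 ^ k * 2 ^ l)).
      * unfold c, r, Rdiv. rewrite <- Rmult_minus_distr_r, <- Rmult_plus_distr_r.
        split; apply Rmult_lt_compat_r; lra.
      * rewrite Rplus_assoc, <- Ev.
        replace (INR u) with (2 ^ k * x - orb k x) by lra. field. lra.
  - rewrite rsum_const, rsum_const, !INR_pow2. unfold r. rewrite El.
    apply Req_le. field. lra.
  - apply (outer_le_finite_union _ (fun u x => exists v, (v < 2 ^ (l - M))%nat /\
       c u v - r < x < c u v + r)). intros u _.
    apply (outer_le_finite_union _ (fun v x => c u v - r < x < c u v + r)). intros v _.
    apply outer_le_interval with (c := c u v); [lra|auto].
Qed.

(** Union bound over pairs of times. For [n] of order [2 ^ m] and [M = m + ht m] the result is of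
    order [(/ 2 ^ ht m) ^ 2], that is [m^(-3/2)]. *)
Lemma outer_le_two_clusters n M :
  outer_le (fun x => 0 <= x < 1 /\ exists k l, (k + l < n)%nat /\ (M <= l)%nat /\
              orb k x < / 2 ^ M /\ orb (k + l) x < / 2 ^ M)
           (INR n ^ 2 * (2 * (/ 2 ^ M) ^ 2)).
Proof.
  assert (H0 : 0 <= 2 * (/ 2 ^ M) ^ 2) by (pose proof (pow2_ge_0 (/ 2 ^ M)); lra).
  apply outer_le_weaken with
    (E := fun x => exists k, (k < n)%nat /\ exists l, (l < n)%nat /\
       ((M <= l)%nat /\ 0 <= x < 1 /\ orb k x < / 2 ^ M /\ orb (k + l) x < / 2 ^ M))
    (p := rsum n (fun _ => rsum n (fun _ => 2 * (/ 2 ^ M) ^ 2))).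
  - intros x (Hx & k & l & Hkl & Hl & H1 & H2).
    exists k; split; [lia|]. exists l; split; [lia|]. auto.
  - rewrite rsum_const, rsum_const. apply Req_le. ring.
  - apply (outer_le_finite_union n (fun k x => exists l, (l < n)%nat /\
       ((M <= l)%nat /\ 0 <= x < 1 /\ orb k x < / 2 ^ M /\ orb (k + l) x < / 2 ^ M))).
    intros k _.
    apply (outer_le_finite_union n (fun l x =>
       ((M <= l)%nat /\ 0 <= x < 1 /\ orb k x < / 2 ^ M /\ orb (k + l) x < / 2 ^ M))).
    intros l _. destruct (le_lt_dec M l) as [H|H].
    + apply outer_le_weaken with (3 := outer_le_orb_two_small k l M H); [tauto|lra].
    + apply outer_le_empty; [intros x (? & _); lia|assumption].
Qed.

Lemma outer_le_any_small n s : 0 <= s ->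
  outer_le (fun x => 0 <= x < 1 /\ exists k, (k < n)%nat /\ orb k x < s)
           (INR n * (2 * s)).
Proof.
  intros Hs.
  apply outer_le_weaken with
    (E := fun x => exists k, (k < n)%nat /\ (0 <= x < 1 /\ orb k x < s))
    (p := rsum n (fun _ => 2 * s)).
  - intros x (Hx & k & Hk & H). exists k; auto.
  - rewrite rsum_const. lra.
  - apply (outer_le_finite_union n (fun k x => 0 <= x < 1 /\ orb k x < s)).
    intros k _. now apply outer_le_orb_small.
Qed.

Definition avg (N : nat) (F : nat -> R) : R := rsum (2 ^ N) F / 2 ^ N.

(** Cell [j] is charged in proportion to [F j]: the charge pays for a cover of length [2 / 2 ^ N] as
    soon as [c <= F j], and the other cells contribute nothing to the event. *)
Lemma markov N (F : nat -> R) c : 0 < c -> (forall j, 0 <= F j) ->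
  outer_le (fun x => 0 <= x < 1 /\
     exists j, 2 ^ N * x = INR j + orb N x /\ c <= F j) (2 * avg N F / c).
Proof.
  intros Hc HF. pose proof (pow2_pos N) as HN.
  assert (HiN : 0 < / 2 ^ N) by now apply Rinv_0_lt_compat.
  apply outer_le_weaken with
    (E := fun x => exists j, (j < 2 ^ N)%nat /\
       (0 <= x < 1 /\ 2 ^ N * x = INR j + orb N x /\ c <= F j))
    (p := rsum (2 ^ N) (fun j => 2 * / 2 ^ N / c * F j)).
  - intros x (Hx & j & E & Hj). exists j; split; [|auto].
    pose proof (orb_range N x Hx). apply INR_lt. rewrite INR_pow2. nra.
  - rewrite rsum_scal. unfold avg. apply Req_le. field. lra.
  - apply (outer_le_finite_union _ (fun j x =>
       0 <= x < 1 /\ 2 ^ N * x = INR j + orb N x /\ c <= F j)).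
    intros j _.
    assert (H1 : 0 < 2 * / 2 ^ N / c) by (apply Rdiv_lt_0_compat; lra).
    destruct (Rle_lt_dec c (F j)) as [H|H].
    + apply outer_le_weaken with
        (E := fun x => INR j / 2 ^ N - / 2 ^ N < x < INR j / 2 ^ N + / 2 ^ N)
        (p := 2 * / 2 ^ N).
      * intros x (Hx & E & _). pose proof (orb_range N x Hx).
        replace x with ((INR j + orb N x) * / 2 ^ N) by (rewrite <- E; field; lra).
        unfold Rdiv. nra.
      * apply Rle_trans with (2 * / 2 ^ N / c * c); [apply Req_le; field; lra|].
        apply Rmult_le_compat_l; lra.
      * apply outer_le_interval with (c := INR j / 2 ^ N); [lra|auto].
    + apply outer_le_empty; [intros x (_ & _ & H'); lra|].
      apply Rmult_le_pos; [lra|apply HF].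
Qed.

(** * Averages over dyadic cells *)

Lemma avg_ext N F G : (forall j, (j < 2 ^ N)%nat -> F j = G j) -> avg N F = avg N G.
Proof. intros H. unfold avg. now rewrite (rsum_ext _ F G H). Qed.

Lemma avg_le N F G : (forall j, (j < 2 ^ N)%nat -> F j <= G j) -> avg N F <= avg N G.
Proof.
  intros H. apply Rmult_le_compat_r; [|now apply rsum_le].
  left. apply Rinv_0_lt_compat, pow2_pos.
Qed.

Lemma avg_scal N c F : avg N (fun j => c * F j) = c * avg N F.
Proof. unfold avg. rewrite rsum_scal. field. pose proof (pow2_pos N); lra. Qed.

Lemma avg_plus N F G : avg N (fun j => F j + G j) = avg N F + avg N G.
Proof. unfold avg. rewrite rsum_plus. field. pose proof (pow2_pos N); lra. Qed.

Lemma avg_const N c : avg N (fun _ => c) = c.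
Proof. unfold avg. rewrite rsum_const, INR_pow2. field. pose proof (pow2_pos N); lra. Qed.

Lemma avg_rsum N n (F : nat -> nat -> R) :
  avg N (fun j => rsum n (fun k => F k j)) = rsum n (fun k => avg N (F k)).
Proof.
  unfold avg, Rdiv. rewrite rsum_swap, Rmult_comm, <- rsum_scal.
  apply rsum_ext; intros; apply Rmult_comm.
Qed.

(** The last [a] digits of a uniform [N]-digit number are uniform; this is the invariance of
    Lebesgue measure in discrete form. *)
Lemma avg_mod N a F : (a <= N)%nat -> avg N (fun j => F (j mod 2 ^ a)%nat) = avg a F.
Proof.
  intros Ha. unfold avg.
  replace N with (N - a + a)%nat by lia. set (k := (N - a)%nat).
  rewrite Nat.pow_add_r, rsum_mul.
  rewrite (rsum_ext _ _ (fun _ => rsum (2 ^ a) F)).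
  - rewrite rsum_const, INR_pow2, pow_add. field.
    pose proof (pow2_pos k); pose proof (pow2_pos a); lra.
  - intros q _. apply rsum_ext. intros r Hr.
    now rewrite Nat.add_comm, Nat.Div0.mod_add, Nat.mod_small.
Qed.

Lemma mod_pow2_mod i a b :
  (a <= b)%nat -> ((i mod 2 ^ b) mod 2 ^ a = i mod 2 ^ a)%nat.
Proof.
  intros H. rewrite (Nat.div_mod_eq i (2 ^ b)) at 2.
  replace b with (b - a + a)%nat at 2 by lia. rewrite Nat.pow_add_r.
  rewrite Nat.add_comm.
  replace (2 ^ (b - a) * 2 ^ a * (i / 2 ^ b))%nat
    with (2 ^ (b - a) * (i / 2 ^ b) * 2 ^ a)%nat by ring.
  now rewrite Nat.Div0.mod_add.
Qed.

(** The value at the left end of a cell of level [l], hence an upper bound on the cell when [f]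
    decreases. *)
Definition gr (f : R -> R) (l i : nat) : R := f (INR i / 2 ^ l).

(* Averaging over the first l digits turns [f] into a Riemann sum with an offset; by
   monotonicity all of its terms but the first are at most the integral average. *)
Lemma avg_correlation (f : R -> R) l a :
  (forall y z, 0 <= y <= z -> f z <= f y) -> (forall y, 0 <= y -> 0 <= f y) ->
  avg (l + a) (fun i => gr f (l + a) i * gr f a (i mod 2 ^ a)) <=
  avg (l + a) (gr f (l + a)) * avg a (gr f a) +
  avg a (fun v => gr f a v * (/ 2 ^ l * f (INR v / 2 ^ a / 2 ^ l))).
Proof.
  intros Hd Hp. pose proof (pow2_pos l) as Hl. pose proof (pow2_pos a) as Ha.
  assert (Hil : 0 < / 2 ^ l) by now apply Rinv_0_lt_compat.
  assert (Hia : 0 < / 2 ^ a) by now apply Rinv_0_lt_compat.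
  assert (Hila : 0 < / (2 ^ l * 2 ^ a)) by (apply Rinv_0_lt_compat; nra).
  assert (E : avg (l + a) (fun i => gr f (l + a) i * gr f a (i mod 2 ^ a)) =
     avg a (fun v => gr f a v *
       (/ 2 ^ l * rsum (2 ^ l) (fun u => gr f (l + a) (u * 2 ^ a + v))))).
  { unfold avg. rewrite Nat.pow_add_r, rsum_mul, rsum_swap, pow_add.
    unfold Rdiv. rewrite Rmult_comm, <- rsum_scal.
    rewrite (Rmult_comm _ (/ 2 ^ a)), <- rsum_scal.
    apply rsum_ext. intros v Hv.
    rewrite (rsum_ext _ _ (fun u => gr f a v * gr f (l + a) (u * 2 ^ a + v))).
    - rewrite rsum_scal. field. lra.
    - intros u _. rewrite (Nat.add_comm (u * 2 ^ a) v) at 2.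
      rewrite Nat.Div0.mod_add, Nat.mod_small by assumption. ring. }
  rewrite E, <- avg_scal, <- avg_plus.
  apply avg_le. intros v Hv.
  assert (Hfv : 0 <= gr f a v).
  { apply Hp, Rle_mult_inv_pos; [apply pos_INR|lra]. }
  enough (/ 2 ^ l * rsum (2 ^ l) (fun u => gr f (l + a) (u * 2 ^ a + v)) <=
          avg (l + a) (gr f (l + a)) + / 2 ^ l * f (INR v / 2 ^ a / 2 ^ l)) by nra.
  assert (Hpow : (2 ^ l = 1 + (2 ^ l - 1))%nat).
  { pose proof (Nat.pow_nonzero 2 l). lia. }
  rewrite Hpow at 1. rewrite rsum_app. simpl (rsum 1 _).
  assert (Hv0 : gr f (l + a) (0 * 2 ^ a + v) = f (INR v / 2 ^ a / 2 ^ l)).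
  { unfold gr. f_equal. simpl. rewrite pow_add. field. lra. }
  simpl (0 * 2 ^ a + v)%nat in *. rewrite Rplus_0_l, Hv0.
  enough (rsum (2 ^ l - 1) (fun u => gr f (l + a) ((1 + u) * 2 ^ a + v)) <=
          2 ^ l * avg (l + a) (gr f (l + a))) as H.
  { apply Rmult_le_compat_l with (r := / 2 ^ l) in H; [|lra].
    rewrite <- Rmult_assoc, Rinv_l in H by lra. lra. }
  (* The point of index [(1 + u) 2^a + v] lies to the right of the whole block of indices
     [u 2^a + w], so [f] there is at most the average over that block. The term left out, [u = 0]
     before the shift, is the error term. *)
  apply Rle_trans with
    (rsum (2 ^ l - 1) (fun u => / 2 ^ a * rsum (2 ^ a) (fun w => gr f (l + a) (u * 2 ^ a + w)))).
  - apply rsum_le. intros u _.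
    apply Rle_trans with (/ 2 ^ a * rsum (2 ^ a) (fun w => gr f (l + a) ((1 + u) * 2 ^ a + v))).
    + rewrite rsum_const, INR_pow2. apply Req_le. field. lra.
    + apply Rmult_le_compat_l; [lra|]. apply rsum_le. intros w Hw.
      apply Hd. rewrite pow_add. split.
      * apply Rle_mult_inv_pos; [apply pos_INR|nra].
      * apply Rmult_le_compat_r; [lra|]. apply le_INR. lia.
  - apply Rle_trans with
      (rsum (2 ^ l) (fun u => / 2 ^ a * rsum (2 ^ a) (fun w => gr f (l + a) (u * 2 ^ a + w)))).
    + apply rsum_mono_n; [lia|]. intros u. apply Rmult_le_pos; [lra|].
      apply rsum_nonneg. intros w _. apply Hp. apply Rle_mult_inv_pos; [apply pos_INR|].
      apply pow2_pos.
    + rewrite rsum_scal, <- rsum_mul, <- Nat.pow_add_r. unfold avg. rewrite pow_add.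
      apply Req_le. field. lra.
Qed.

(** * Correlations and variance of [1 / (x + t)] *)

Definition smooth (t y : R) : R := / (y + t).

(** A Riemann sum for the integral of [1 / (x + s)^2], which is below [1 / s]. With [z = v + s 2^a],
    [1 / z^2 <= 1 / ((z - 1) z)] telescopes, and a mesh of at most [s / 2] limits the loss to a
    factor 2. *)
Lemma avg_inv_square a s : 2 <= s * 2 ^ a ->
  avg a (fun v => / (INR v / 2 ^ a + s) ^ 2) <= 2 / s.
Proof.
  intros Hs. pose proof (pow2_pos a) as Ha. set (V := 2 ^ a) in *.
  assert (Hs0 : 0 < s) by nra.
  assert (T : forall K, rsum K (fun v => / (INR v / V + s) ^ 2) <=
                        V * (V / (s * V - 1) - V / (INR K + s * V - 1))).
  { induction K as [|K IH].
    - simpl. apply Req_le. field. lra.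
    - change (rsum (S K) ?f) with (rsum K f + f K). cbv beta.
      apply Rle_trans with (1 := Rplus_le_compat_r _ _ _ IH).
      pose proof (pos_INR K) as HK. rewrite S_INR.
      set (z := INR K + s * V) in *.
      replace (INR K + 1 + s * V - 1) with z by (unfold z; ring).
      assert (Hz : 2 <= z) by (unfold z; lra).
      replace (/ (INR K / V + s) ^ 2) with (V * (V * / (z * z)))
        by (unfold z; field; split; nra).
      enough (V * / (z * z) <= V / (z - 1) - V / z) by nra.
      replace (V / (z - 1) - V / z) with (V * / ((z - 1) * z)) by (field; lra).
      apply Rmult_le_compat_l; [lra|]. apply Rinv_le_contravar; nra. }
  pose proof (INR_pow2 a) as HI. fold V in HI. unfold avg. fold V.
  apply Rle_trans with (V * (V / (s * V - 1)) / V).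
  - apply Rmult_le_compat_r; [left; now apply Rinv_0_lt_compat|].
    apply Rle_trans with (1 := T _). apply Rmult_le_compat_l; [lra|].
    assert (0 <= V / (INR (2 ^ a) + s * V - 1)) by (apply Rle_mult_inv_pos; lra). lra.
  - replace (V * (V / (s * V - 1)) / V) with (V / (s * V - 1)) by (field; lra).
    apply Rmult_le_reg_r with (s * V - 1); [lra|].
    replace (V / (s * V - 1) * (s * V - 1)) with V by (field; lra).
    replace (2 / s * (s * V - 1)) with (2 * V - 2 / s) by (field; lra).
    enough (2 / s <= V) by lra. apply Rmult_le_reg_r with s; [lra|].
    replace (2 / s * s) with 2 by (field; lra). lra.
Qed.

(** The error term of [avg_correlation] is the mean of [1 / (y + t)] times [1 / (y + 2^l t)].
    Cauchy-Schwarz would give order [2^(-l/2) / t]; the weight [c = (3/4)^l] avoids the square root,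
    since both [c] and [1 / (c 2^l) = (2/3)^l] are at most [(3/4)^l]. *)
Lemma smooth_correlation t l a : 0 < t -> 2 <= t * 2 ^ a ->
  avg (l + a) (fun i => gr (smooth t) (l + a) i * gr (smooth t) a (i mod 2 ^ a)) <=
  avg (l + a) (gr (smooth t) (l + a)) * avg a (gr (smooth t) a) + 2 / t * (3 / 4) ^ l.
Proof.
  intros Ht Hta. pose proof (pow2_pos l) as Hl. pose proof (pow2_pos a) as Ha.
  eapply Rle_trans; [apply avg_correlation|].
  - intros y z Hyz. apply Rinv_le_contravar; lra.
  - intros y Hy. left. apply Rinv_0_lt_compat. lra.
  - apply Rplus_le_compat_l.
    set (c := (3 / 4) ^ l). assert (Hc : 0 < c) by (apply pow_lt; lra).
    set (s := 2 ^ l * t).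
    assert (Hl1 : 1 <= 2 ^ l) by (apply pow_R1_Rle; lra).
    apply Rle_trans with (avg a (fun v => c / 2 * / (INR v / 2 ^ a + t) ^ 2 +
                                          / (2 * c) * / (INR v / 2 ^ a + s) ^ 2)).
    + apply avg_le. intros v _. unfold gr, smooth.
      assert (Hy : 0 <= INR v / 2 ^ a) by (apply Rle_mult_inv_pos; [apply pos_INR|lra]).
      set (y := INR v / 2 ^ a) in *.
      assert (0 < s) by (unfold s; nra).
      replace (/ 2 ^ l * / (y / 2 ^ l + t)) with (/ (y + s))
        by (replace (y / 2 ^ l + t) with ((y + s) / 2 ^ l) by (unfold s; field; lra);
            field; lra).
      (* AM-GM: [p q <= c p^2 / 2 + q^2 / (2 c)] *)
      assert (Hp : 0 < / (y + t)) by (apply Rinv_0_lt_compat; lra).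
      assert (Hq : 0 < / (y + s)) by (apply Rinv_0_lt_compat; lra).
      rewrite <- !pow_inv.
      set (p := / (y + t)) in *. set (q := / (y + s)) in *.
      pose proof (pow2_ge_0 (c * p - q)) as Hsq.
      assert (Hic : 0 < / (2 * c)) by (apply Rinv_0_lt_compat; lra).
      apply Rmult_le_compat_l with (r := / (2 * c)) in Hsq; [|lra].
      replace (/ (2 * c) * (c * p - q) ^ 2) with
        (c / 2 * p ^ 2 + / (2 * c) * q ^ 2 - p * q) in Hsq by (field; lra).
      lra.
    + rewrite avg_plus, !avg_scal.
      assert (Hs : 2 <= s * 2 ^ a) by (unfold s; nra).
      pose proof (avg_inv_square a t Hta) as H1. pose proof (avg_inv_square a s Hs) as H2.
      assert (Hic : 0 < / (2 * c)) by (apply Rinv_0_lt_compat; lra).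
      apply Rle_trans with (c / 2 * (2 / t) + / (2 * c) * (2 / s)).
      * apply Rplus_le_compat; apply Rmult_le_compat_l; lra.
      * replace (c / 2 * (2 / t) + / (2 * c) * (2 / s)) with (/ t * (c + / (c * 2 ^ l)))
          by (unfold s; field; lra).
        replace (2 / t * c) with (/ t * (c + c)) by (field; lra).
        apply Rmult_le_compat_l; [left; apply Rinv_0_lt_compat; lra|].
        apply Rplus_le_compat_l. unfold c.
        rewrite <- Rpow_mult_distr, <- pow_inv. apply pow_incr.
        replace (/ (3 / 4 * 2)) with (2 / 3) by field. lra.
Qed.

(** With truncated subtraction, [(k - j) + (j - k)] is the distance of [j] and [k]. Each side of [k]
    contributes at most 4. *)
Lemma rsum_geometric_two_sided k n :
  rsum n (fun j => (3 / 4) ^ ((k - j) + (j - k))) <= 8.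
Proof.
  assert (H1 : forall n, (n <= k + 1)%nat ->
    rsum n (fun j => (3 / 4) ^ ((k - j) + (j - k))) <= 4 * (3 / 4) ^ (k + 1 - n)).
  { clear n. induction n as [|n IH]; intros Hn.
    - simpl. pose proof (pow_le (3 / 4) (k + 1 - 0)). lra.
    - change (rsum (S n) ?f) with (rsum n f + f n). cbv beta.
      replace (k - n + (n - k))%nat with (k + 1 - S n)%nat by lia.
      specialize (IH ltac:(lia)). replace (k + 1 - n)%nat with (S (k + 1 - S n)) in IH by lia.
      simpl pow in IH. lra. }
  assert (H2 : forall i, rsum (k + 1 + i) (fun j => (3 / 4) ^ ((k - j) + (j - k)))
                         <= 8 - 4 * (3 / 4) ^ i).
  { induction i as [|i IH].
    - rewrite Nat.add_0_r. eapply Rle_trans; [apply H1; lia|].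
      rewrite Nat.sub_diag. simpl. lra.
    - rewrite Nat.add_succ_r. change (rsum (S ?n) ?f) with (rsum n f + f n). cbv beta.
      replace (k - (k + 1 + i) + (k + 1 + i - k))%nat with (S i) by lia.
      simpl pow. pose proof (pow_le (3 / 4) i). lra. }
  apply Rle_trans with (rsum (k + 1 + n) (fun j => (3 / 4) ^ ((k - j) + (j - k)))).
  - apply rsum_mono_n; [lia|]. intros; apply pow_le; lra.
  - eapply Rle_trans; [apply H2|]. pose proof (pow_le (3 / 4) n). lra.
Qed.

(** At time [k] only [N - k] digits are left, so the observables are sampled at different levels and
    each is centred at its own mean. The last hypothesis keeps even the coarsest level fine enough
    for [avg_inv_square]. *)
Lemma smooth_variance t n N : 0 < t -> (n <= N)%nat -> 2 <= t * 2 ^ (N - n) ->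
  avg N (fun j => (rsum n (fun k => gr (smooth t) (N - k) (j mod 2 ^ (N - k))) -
                   rsum n (fun k => avg (N - k) (gr (smooth t) (N - k)))) ^ 2)
  <= 16 * INR n / t.
Proof.
  intros Ht HN Ht2.
  set (X := fun k j => gr (smooth t) (N - k) (j mod 2 ^ (N - k))).
  set (mu := fun k => avg (N - k) (gr (smooth t) (N - k))).
  change (avg N (fun j => (rsum n (fun k => X k j) - rsum n mu) ^ 2) <= 16 * INR n / t).
  assert (Hmu : forall k, avg N (X k) = mu k).
  { intros k. unfold X, mu. apply (avg_mod N (N - k) (gr (smooth t) (N - k))). lia. }
  assert (Hle : forall k k', (k <= k')%nat -> (k' < n)%nat ->
    avg N (fun j => X k j * X k' j) - mu k * mu k' <= 2 / t * (3 / 4) ^ ((k - k') + (k' - k))).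
  { intros k k' Hk Hk'.
    replace (k - k' + (k' - k))%nat with (k' - k)%nat by lia.
    (* Both factors depend only on the last [N - k] digits, so the average descends to that level,
       where the [k' - k] leading digits separate the two times. *)
    rewrite (avg_ext N _ (fun j => (fun i => gr (smooth t) (N - k) i *
       gr (smooth t) (N - k') (i mod 2 ^ (N - k')))%R (j mod 2 ^ (N - k))%nat)).
    - rewrite (avg_mod N (N - k) (fun i => gr (smooth t) (N - k) i *
       gr (smooth t) (N - k') (i mod 2 ^ (N - k')))) by lia.
      unfold mu. replace (N - k)%nat with ((k' - k) + (N - k'))%nat by lia.
      enough (2 <= t * 2 ^ (N - k')) as H
        by (pose proof (smooth_correlation t (k' - k) (N - k') Ht H); lra).
      apply Rle_trans with (1 := Ht2). apply Rmult_le_compat_l; [lra|].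
      apply Rle_pow; [lra|lia].
    - intros j _. unfold X. cbv beta. rewrite mod_pow2_mod by lia. reflexivity. }
  assert (Hcov : forall k k', (k < n)%nat -> (k' < n)%nat ->
    avg N (fun j => X k j * X k' j) - mu k * mu k' <= 2 / t * (3 / 4) ^ ((k - k') + (k' - k))).
  { intros k k' Hk Hk'. destruct (le_lt_dec k k') as [H|H]; [now apply Hle|].
    rewrite Nat.add_comm, (Rmult_comm (mu k)).
    rewrite (avg_ext N _ (fun j => X k' j * X k j)) by (intros; ring).
    apply Hle; lia. }
  (* The square is expanded over pairs of times; on averaging, the four terms combine to the
     covariance. *)
  rewrite (avg_ext N _ (fun j => rsum n (fun k => rsum n (fun k' =>
    X k j * X k' j + (- mu k) * X k' j + (- mu k') * X k j + mu k * mu k')))).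
  2:{ intros j _. rewrite <- rsum_minus. simpl pow. rewrite Rmult_1_r, rsum_prod.
      apply rsum_ext; intros k _. apply rsum_ext; intros k' _. ring. }
  rewrite avg_rsum.
  apply Rle_trans with (rsum n (fun k => rsum n (fun k' =>
    2 / t * (3 / 4) ^ ((k - k') + (k' - k))))).
  - apply rsum_le. intros k Hk. rewrite avg_rsum. apply rsum_le. intros k' Hk'.
    rewrite !avg_plus, !avg_scal, avg_const, !Hmu.
    specialize (Hcov k k' Hk Hk'). lra.
  - apply Rle_trans with (rsum n (fun _ => 2 / t * 8)).
    + apply rsum_le. intros k _. rewrite rsum_scal. apply Rmult_le_compat_l.
      * apply Rle_mult_inv_pos; lra.
      * apply rsum_geometric_two_sided.
    + rewrite rsum_const. apply Req_le. field. lra.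
Qed.

(** * Mean of [1 / (x + t)] and the Chebyshev bound *)

Lemma ln_le_sub1 y : 0 < y -> ln y <= y - 1.
Proof.
  intros Hy. destruct (Req_dec (ln y) 0) as [E|E].
  - rewrite E. assert (y = 1) by (apply ln_inv; [lra|lra|rewrite ln_1; assumption]). lra.
  - pose proof (exp_ineq1 (ln y) E). rewrite exp_ln in H by assumption. lra.
Qed.

Lemma ln_div y z : 0 < y -> 0 < z -> ln (y / z) = ln y - ln z.
Proof.
  intros Hy Hz. unfold Rdiv.
  rewrite ln_mult, ln_Rinv by (try apply Rinv_0_lt_compat; lra). lra.
Qed.

Lemma ln_step w : 0 < w -> / (w + 1) <= ln (w + 1) - ln w <= / w.
Proof.
  intros Hw. rewrite <- ln_div by lra. split.
  - pose proof (ln_le_sub1 (w / (w + 1))) as H.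
    rewrite ln_div in H by lra. rewrite ln_div by lra.
    assert (0 < w / (w + 1)) by (apply Rdiv_lt_0_compat; lra).
    replace (w / (w + 1) - 1) with (- / (w + 1)) in H by (field; lra). lra.
  - pose proof (ln_le_sub1 ((w + 1) / w)) as H.
    assert (0 < (w + 1) / w) by (apply Rdiv_lt_0_compat; lra).
    replace ((w + 1) / w - 1) with (/ w) in H by (field; lra). lra.
Qed.

(** The term [- / (z + INR K)] makes the upper bound inductive: it shifts the sum by one index, so
    that the step needs only the lower half of [ln_step]. *)
Lemma rsum_harmonic z K : 0 < z ->
  ln (z + INR K) - ln z <= rsum K (fun i => / (INR i + z))
    <= / z + ln (z + INR K) - ln z - / (z + INR K).
Proof.
  intros Hz. induction K as [|K IH].
  - simpl. rewrite Rplus_0_r. lra.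
  - change (rsum (S K) ?f) with (rsum K f + f K). cbv beta. rewrite S_INR.
    pose proof (pos_INR K) as HK. pose proof (ln_step (z + INR K) ltac:(lra)) as H.
    replace (z + (INR K + 1)) with (z + INR K + 1) by ring.
    rewrite (Rplus_comm (INR K) z). lra.
Qed.

(** The integral of [1 / (x + t)] over the unit interval is [ln (/ t) + ln (1 + t)]. The slack 2 is
    1 for [ln (1 + t)] plus 1 for the Riemann sum error [/ z]. *)
Lemma smooth_mean t l : 0 < t <= 1 -> 1 <= t * 2 ^ l ->
  ln (/ t) <= avg l (gr (smooth t) l) <= ln (/ t) + 2.
Proof.
  intros Ht Hl. pose proof (pow2_pos l) as Hp.
  set (z := t * 2 ^ l) in *.
  assert (E : avg l (gr (smooth t) l) = rsum (2 ^ l) (fun i => / (INR i + z))).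
  { unfold avg, Rdiv. rewrite Rmult_comm, <- rsum_scal. apply rsum_ext. intros i _.
    unfold gr, smooth, z. pose proof (pos_INR i). field. split; [nra|lra]. }
  rewrite E. pose proof (rsum_harmonic z (2 ^ l) ltac:(lra)) as H.
  rewrite INR_pow2 in H.
  assert (E2 : ln (z + 2 ^ l) - ln z = ln (/ t) + ln (1 + t)).
  { rewrite <- ln_div, <- ln_mult by (try apply Rinv_0_lt_compat; lra).
    f_equal. unfold z. field. lra. }
  assert (0 <= ln (1 + t)) by (left; rewrite <- ln_1; apply ln_increasing; lra).
  pose proof (ln_le_sub1 (1 + t) ltac:(lra)).
  assert (/ z <= 1) by (rewrite <- Rinv_1; apply Rinv_le_contravar; lra).
  assert (0 < / (z + 2 ^ l)) by (apply Rinv_0_lt_compat; lra). lra.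
Qed.

(** Of the slack [3 * INR n], two parts absorb the means of [smooth_mean] and one the replacement of
    orbit points by grid points, at most 1 per term. *)
Lemma outer_le_smooth_deviation t n c : 0 < t <= 1 -> 0 < c ->
  outer_le (fun x => 0 <= x < 1 /\
      c + 3 * INR n <= Rabs (rsum n (fun k => smooth t (orb k x)) - INR n * ln (/ t)))
    (32 * INR n / (t * c ^ 2)).
Proof.
  intros Ht Hc.
  (* [R0] extra digits make every cell shorter than [t ^ 2]; as [1 / (x + t)] has slope at most
     [1 / t ^ 2], it then varies by at most 1 on a cell. *)
  destruct (Pow_x_infinity 2) with (b := 2 / t ^ 2) as [R0 HR0].
  { rewrite Rabs_right; lra. }
  specialize (HR0 R0 (le_n _)). rewrite Rabs_right in HR0 by (left; apply pow2_pos).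
  assert (Ht2 : 0 < t ^ 2) by (apply pow_lt; lra).
  assert (HR1 : 2 <= t ^ 2 * 2 ^ R0).
  { apply Rge_le in HR0. apply Rmult_le_compat_l with (r := t ^ 2) in HR0; [|lra].
    replace (t ^ 2 * (2 / t ^ 2)) with 2 in HR0 by (field; lra). exact HR0. }
  pose proof (pow2_pos R0) as HR.
  assert (HR2 : 2 <= t * 2 ^ R0) by (simpl pow in HR1 at 1; nra).
  set (N := (n + R0)%nat).
  assert (HN : (N - n = R0)%nat) by (unfold N; lia).
  assert (Hlev : forall k, (k < n)%nat -> 2 ^ R0 <= 2 ^ (N - k)).
  { intros k Hk. apply Rle_pow; [lra|unfold N; lia]. }
  set (S1 := fun j => rsum n (fun k => gr (smooth t) (N - k) (j mod 2 ^ (N - k)))).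
  set (M1 := rsum n (fun k => avg (N - k) (gr (smooth t) (N - k)))).
  assert (HM1 : INR n * ln (/ t) <= M1 <= INR n * ln (/ t) + 2 * INR n).
  { assert (H : forall k, (k < n)%nat ->
      ln (/ t) <= avg (N - k) (gr (smooth t) (N - k)) <= ln (/ t) + 2).
    { intros k Hk. apply smooth_mean; [assumption|]. specialize (Hlev k Hk). nra. }
    unfold M1. split.
    - rewrite <- rsum_const. apply rsum_le. intros; now apply H.
    - replace (INR n * ln (/ t) + 2 * INR n) with (INR n * (ln (/ t) + 2)) by ring.
      rewrite <- rsum_const. apply rsum_le. intros; now apply H. }
  assert (Hv : avg N (fun j => (S1 j - M1) ^ 2) <= 16 * INR n / t).
  { apply smooth_variance; [lra|unfold N; lia|now rewrite HN]. }
  apply outer_le_weaken with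
    (3 := markov N (fun j => (S1 j - M1) ^ 2) (c ^ 2) (pow_lt _ 2 Hc)
            (fun j => pow2_ge_0 _)).
  - intros x (Hx & Hdev). split; [assumption|].
    destruct (orb_digits N x Hx) as (j & Hj & E). exists j; split; [assumption|].
    assert (Hd : S1 j - INR n <= rsum n (fun k => smooth t (orb k x)) <= S1 j).
    { assert (H : forall k, (k < n)%nat ->
        gr (smooth t) (N - k) (j mod 2 ^ (N - k)) - 1 <= smooth t (orb k x)
          <= gr (smooth t) (N - k) (j mod 2 ^ (N - k))).
      { intros k Hk. specialize (Hlev k Hk).
        assert (Hdm := digit_mod N (N - k) x j Hx ltac:(lia) E).
        replace (N - (N - k))%nat with k in Hdm by (unfold N; lia).
        pose proof (orb_range k x Hx) as Hy.
        set (v := (j mod 2 ^ (N - k))%nat) in *. pose proof (pos_INR v) as Hv0.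
        set (V := 2 ^ (N - k)) in *. set (y := orb k x) in *.
        assert (HV : 0 < V) by lra.
        unfold gr, smooth. fold V. set (w := INR v / V).
        assert (Ew : INR v = w * V) by (unfold w; field; lra).
        rewrite Ew in Hdm.
        assert (Hw0 : 0 <= w) by (apply Rle_mult_inv_pos; lra).
        assert (Hwy : w <= y) by nra.
        assert (Hyw : (y - w) * V <= 1) by nra.
        assert (Hyw2 : y - w <= t ^ 2).
        { apply Rmult_le_reg_r with V; [lra|]. apply Rle_trans with (1 := Hyw).
          assert (t ^ 2 * 2 ^ R0 <= t ^ 2 * V) by (apply Rmult_le_compat_l; lra). lra. }
        split.
        - apply Rplus_le_reg_r with (1 - / (y + t)).
          replace (/ (w + t) - 1 + (1 - / (y + t))) with ((y - w) / ((w + t) * (y + t)))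
            by (field; lra).
          replace (/ (y + t) + (1 - / (y + t))) with 1 by ring.
          apply Rmult_le_reg_r with ((w + t) * (y + t)); [nra|].
          replace ((y - w) / ((w + t) * (y + t)) * ((w + t) * (y + t))) with (y - w)
            by (field; lra). nra.
        - apply Rinv_le_contravar; lra. }
      unfold S1. split.
      - replace (INR n) with (rsum n (fun _ => 1)) by (rewrite rsum_const; ring).
        rewrite <- rsum_minus. apply rsum_le. intros; now apply H.
      - apply rsum_le. intros; now apply H. }
    assert (Hc2 : c <= Rabs (S1 j - M1)).
    { pose proof (pos_INR n). revert Hdev. unfold Rabs.
      destruct (Rcase_abs _); destruct (Rcase_abs _); lra. }
    rewrite <- (pow2_abs (S1 j - M1)). apply pow_incr. lra.
  - assert (0 < c ^ 2) by (apply pow_lt; lra).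
    replace (32 * INR n / (t * c ^ 2)) with (2 * (16 * INR n / t) / c ^ 2)
      by (field; lra).
    apply Rmult_le_compat_r; [left; now apply Rinv_0_lt_compat|]. lra.
Qed.

(** * Trimmed sums *)

Definition lsum (g : option nat -> R) (l : list (option nat)) : R :=
  fold_right (fun u s => g u + s) 0 l.

Lemma lsum_app g l1 l2 : lsum g (l1 ++ l2) = lsum g l1 + lsum g l2.
Proof. induction l1 as [|u l1 IH]; simpl; [ring|]. rewrite IH; ring. Qed.

Lemma lsum_perm g l1 l2 : Permutation l1 l2 -> lsum g l1 = lsum g l2.
Proof. induction 1; simpl; lra. Qed.

Lemma lsum_le g h l : (forall u, g u <= h u) -> lsum g l <= lsum h l.
Proof. intros H. induction l as [|u l IH]; simpl; [lra|]. specialize (H u). lra. Qed.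

Lemma lsum_bound g f l : 0 <= f -> (forall u, g u <= f) -> lsum g l <= INR (length l) * f.
Proof.
  intros Hf H. induction l as [|u l IH]; [simpl; lra|].
  change (length (u :: l)) with (S (length l)). rewrite S_INR. simpl.
  specialize (H u). lra.
Qed.

Lemma ext_val_nonneg u : 0 <= ext_val u.
Proof. destruct u; simpl; [apply pos_INR|lra]. Qed.

Lemma lsum_val_nonneg l : 0 <= lsum ext_val l.
Proof. induction l as [|u l IH]; simpl; [lra|]. pose proof (ext_val_nonneg u). lra. Qed.

Lemma ext_sum_finite l : Forall (fun u => u <> None) l ->
  ext_sum l <> None /\ ext_val (ext_sum l) = lsum ext_val l.
Proof.
  induction 1 as [|u l Hu Hl [IH1 IH2]]; simpl; [split; [discriminate|reflexivity]|].
  fold (ext_sum l). destruct u as [m|]; [|congruence].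
  destruct (ext_sum l) as [s|]; [|congruence]. simpl in *.
  split; [discriminate|]. now rewrite plus_INR, IH2.
Qed.

Lemma ins_desc_perm u l : Permutation (u :: l) (ins_desc u l).
Proof.
  induction l as [|v l IH]; simpl; [reflexivity|]. destruct (ext_le v u); [reflexivity|].
  rewrite perm_swap. now constructor.
Qed.

Lemma sort_desc_perm l : Permutation l (sort_desc l).
Proof.
  induction l as [|u l IH]; simpl; [constructor|].
  rewrite <- ins_desc_perm. now constructor.
Qed.

(** Since [ext_val None] is 0 while [ext_le] puts [None] on top, this order agrees with the sorting
    only on lists of finite entries. *)
Definition val_ge (u v : option nat) : Prop := ext_val v <= ext_val u.

Lemma ins_desc_sorted u l : u <> None -> Forall (fun v => v <> None) l ->
  StronglySorted val_ge l -> StronglySorted val_ge (ins_desc u l).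
Proof.
  intros Hu Hl Hs. induction l as [|v l IH]; simpl.
  - repeat constructor.
  - inversion Hl as [|? ? Hv Hl']; subst. inversion Hs as [|? ? Hs' Hvl]; subst.
    destruct u as [p|]; [|congruence]. destruct v as [q|]; [|congruence]. simpl.
    destruct (Nat.leb_spec q p) as [H|H].
    + assert (Hqp : val_ge (Some p) (Some q)) by now apply le_INR.
      constructor; [assumption|]. constructor; [assumption|].
      revert Hvl. apply Forall_impl. intros w Hw. unfold val_ge in *. lra.
    + constructor; [now apply IH|].
      apply (Permutation_Forall (ins_desc_perm (Some p) l)).
      constructor; [|assumption]. apply le_INR. lia.
Qed.

Lemma sort_desc_sorted l : Forall (fun v => v <> None) l ->
  StronglySorted val_ge (sort_desc l).
Proof.
  induction 1 as [|u l Hu Hl IH]; simpl; [constructor|].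
  apply ins_desc_sorted; auto. now apply (Permutation_Forall (sort_desc_perm l)).
Qed.

(** After capping at [f], the [b] removed entries are worth at most [f] each. *)
Lemma lsum_trim_ge l b f : 0 <= f ->
  lsum (fun u => Rmin (ext_val u) f) l - INR b * f <= lsum ext_val (skipn b l).
Proof.
  intros Hf. rewrite <- (firstn_skipn b l) at 1. rewrite lsum_app.
  assert (H1 : lsum (fun u => Rmin (ext_val u) f) (firstn b l) <= INR b * f).
  { eapply Rle_trans; [apply lsum_bound; [exact Hf|intros; apply Rmin_r]|].
    apply Rmult_le_compat_r; [assumption|]. apply le_INR, firstn_le_length. }
  assert (H2 : lsum (fun u => Rmin (ext_val u) f) (skipn b l) <= lsum ext_val (skipn b l))
    by (apply lsum_le; intros; apply Rmin_l).
  lra.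
Qed.

(** Removing the largest entries is optimal, so any convenient choice [l1] of at most [b] entries
    gives an upper bound without knowledge of the sorting permutation. *)
Lemma lsum_trim_le b : forall s l1 l2,
  StronglySorted val_ge s -> Permutation s (l1 ++ l2) -> (length l1 <= b)%nat ->
  lsum ext_val (skipn b s) <= lsum ext_val l2.
Proof.
  induction b as [|b IH]; intros s l1 l2 Hs Hp Hb.
  - destruct l1; [|simpl in Hb; lia]. simpl in *. rewrite (lsum_perm _ _ _ Hp). lra.
  - destruct s as [|u s]; [simpl; apply lsum_val_nonneg|]. simpl.
    inversion Hs as [|? ? Hs' Hu]; subst.
    assert (Hin : In u (l1 ++ l2)) by (apply (Permutation_in u Hp); now left).
    apply in_app_or in Hin. destruct Hin as [Hin|Hin].
    + apply in_split in Hin. destruct Hin as (l3 & l4 & ->).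
      apply (IH s (l3 ++ l4)); [assumption| |].
      * apply Permutation_cons_inv with u. rewrite Hp, <- !app_assoc. simpl.
        symmetry. apply Permutation_middle.
      * rewrite length_app in *. simpl in Hb. lia.
    + apply in_split in Hin. destruct Hin as (l3 & l4 & ->).
      assert (Hp' : Permutation s (l1 ++ l3 ++ l4)).
      { apply Permutation_cons_inv with u. rewrite Hp, !app_assoc.
        symmetry. apply Permutation_middle. }
      destruct l1 as [|w l1].
      * apply Rle_trans with (lsum ext_val (l3 ++ l4)).
        -- apply (IH s nil); [assumption|assumption|simpl; lia].
        -- rewrite !lsum_app. simpl. pose proof (ext_val_nonneg u). lra.
      (* Exchange: the maximum [u] was kept in [l2], so some [w] of [l1] takes its place there,
         which cannot increase the sum. *)
      * assert (Hwu : val_ge u w).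
        { rewrite Forall_forall in Hu. apply Hu.
          apply (Permutation_in w (Permutation_sym Hp')). now left. }
        apply Rle_trans with (lsum ext_val (w :: l3 ++ l4)).
        -- apply (IH s l1); [assumption| |simpl in Hb; lia].
           rewrite Hp'. simpl. apply Permutation_middle.
        -- simpl. rewrite !lsum_app. simpl. unfold val_ge in Hwu. lra.
Qed.

Lemma lsum_a_list g n x : lsum g (a_list n x) = rsum n (fun k => g (chi (orb k x))).
Proof.
  unfold a_list. induction n as [|n IH]; [reflexivity|].
  rewrite seq_S, map_app, lsum_app, IH.
  cbn [rsum map lsum fold_right]. unfold a. fold (orb (1 + n - 1) x).
  replace (1 + n - 1)%nat with n by lia. ring.
Qed.

Lemma Permutation_filter_split {A} (P : A -> bool) l :
  Permutation l (filter P l ++ filter (fun u => negb (P u)) l).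
Proof.
  induction l as [|u l IH]; simpl; [constructor|]. destruct (P u); simpl.
  - now constructor.
  - apply Permutation_cons_app. exact IH.
Qed.

Definition in_block (k0 b k : nat) : bool := andb (Nat.leb k0 k) (Nat.ltb k (k0 + b)).

Lemma in_block_spec k0 b k : in_block k0 b k = true <-> (k0 <= k < k0 + b)%nat.
Proof.
  unfold in_block. rewrite Bool.andb_true_iff, Nat.leb_le, Nat.ltb_lt. tauto.
Qed.

Lemma chi_finite y : 0 < y -> exists m, chi y = Some m /\ / y - 1 < INR m <= / y.
Proof.
  intros Hy. unfold chi. destruct (Req_dec_T y 0) as [E|_]; [lra|].
  exists (Z.to_nat (rfloor (/ y))). split; [reflexivity|]. unfold rfloor.
  assert (Hi : 0 < / y) by now apply Rinv_0_lt_compat.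
  destruct (base_Int_part (/ y)) as [H1 H2].
  assert (0 <= Int_part (/ y))%Z.
  { assert (-1 < Int_part (/ y))%Z by (apply lt_IZR; simpl; lra). lia. }
  rewrite INR_IZR_INZ, Z2Nat.id by assumption. lra.
Qed.

Lemma a_list_finite n x : (forall k, (k < n)%nat -> 0 < orb k x) ->
  Forall (fun u => u <> None) (a_list n x).
Proof.
  intros H. apply Forall_forall. intros u Hu. apply in_map_iff in Hu.
  destruct Hu as (k & <- & Hk). apply in_seq in Hk. unfold a.
  destruct (chi_finite (Nat.iter (k - 1) tau x)) as (m & -> & _); [|discriminate].
  apply H. lia.
Qed.

Lemma trimmed_sum_val n b x : (forall k, (k < n)%nat -> 0 < orb k x) ->
  trimmed_sum n b x <> None /\
  ext_val (trimmed_sum n b x) = lsum ext_val (skipn b (sort_desc (a_list n x))).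
Proof.
  intros H. apply ext_sum_finite.
  pose proof (Permutation_Forall (sort_desc_perm _) (a_list_finite n x H)) as H1.
  rewrite <- (firstn_skipn b (sort_desc _)) in H1. apply Forall_app in H1. tauto.
Qed.

Lemma trimmed_sum_ge n b x f : 0 <= f -> (forall k, (k < n)%nat -> 0 < orb k x) ->
  rsum n (fun k => Rmin (/ orb k x - 1) f) - INR b * f <= ext_val (trimmed_sum n b x).
Proof.
  intros Hf H. destruct (trimmed_sum_val n b x H) as [_ ->].
  eapply Rle_trans; [|apply lsum_trim_ge with (f := f); assumption].
  rewrite <- (lsum_perm _ _ _ (sort_desc_perm _)), lsum_a_list.
  apply Rplus_le_compat_r. apply rsum_le. intros k Hk.
  destruct (chi_finite _ (H k Hk)) as (m & -> & Hm). simpl.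
  apply Rmin_glb; [|apply Rmin_r]. eapply Rle_trans; [apply Rmin_l|]. lra.
Qed.

Lemma trimmed_sum_le n b x k0 : (forall k, (k < n)%nat -> 0 < orb k x) ->
  ext_val (trimmed_sum n b x) <=
  rsum n (fun k => if in_block k0 b k then 0 else / orb k x).
Proof.
  intros H. destruct (trimmed_sum_val n b x H) as [_ ->].
  (* The [k]-th term [a k] reads the orbit at time [k - 1]. *)
  set (P := fun k => in_block k0 b (k - 1)).
  apply Rle_trans with
    (lsum ext_val (map (fun k => a k x) (filter (fun k => negb (P k)) (seq 1 n)))).
  - apply lsum_trim_le with (l1 := map (fun k => a k x) (filter P (seq 1 n))).
    + now apply sort_desc_sorted, a_list_finite.
    + rewrite <- sort_desc_perm, <- map_app. apply Permutation_map.
      apply Permutation_filter_split.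
    (* The removed indices are distinct and lie in the interval of length [b] starting at [S k0]. *)
    + rewrite length_map, <- (length_seq b (S k0)). apply NoDup_incl_length.
      * apply NoDup_filter, seq_NoDup.
      * intros k Hk. apply filter_In in Hk. destruct Hk as [Hk HP].
        apply in_seq in Hk. apply in_block_spec in HP. apply in_seq. lia.
  - induction n as [|n IH]; [simpl; lra|].
    rewrite seq_S, filter_app, map_app, lsum_app.
    change (rsum (S n) ?f) with (rsum n f + f n). cbv beta.
    apply Rplus_le_compat; [apply IH; intros; apply H; lia|].
    simpl. unfold P. replace (S n - 1)%nat with n by lia.
    destruct (in_block k0 b n); simpl; [lra|].
    unfold a. replace (S n - 1)%nat with n by lia. fold (orb n x).
    destruct (chi_finite _ (H n (Nat.lt_succ_diag_r n))) as (m & -> & Hm). simpl. lra.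
Qed.

Lemma first_below (f : nat -> R) s n :
  (forall k, (k < n)%nat -> s <= f k) \/
  exists k0, (k0 < n)%nat /\ f k0 < s /\ forall k, (k < k0)%nat -> s <= f k.
Proof.
  induction n as [|n [IH|(k0 & H & IH)]].
  - left. intros; lia.
  - destruct (Rlt_le_dec (f n) s) as [H|H].
    + right. exists n. auto with arith.
    + left. intros k Hk. destruct (Nat.eq_dec k n) as [->|]; [assumption|apply IH; lia].
  - right. exists k0. auto with arith.
Qed.

Lemma rsum_geometric_tail s b n :
  rsum n (fun k => if Nat.leb (s + b) k then (/ 2) ^ (k - s) else 0) <= 2 * (/ 2) ^ b.
Proof.
  (* Keeping the remainder [2 * (/ 2) ^ (n - s)] makes the bound inductive. *)
  enough (H : rsum n (fun k => if Nat.leb (s + b) k then (/ 2) ^ (k - s) else 0) <=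
              if Nat.leb (s + b) n then 2 * (/ 2) ^ b - 2 * (/ 2) ^ (n - s) else 0).
  { eapply Rle_trans; [exact H|]. pose proof (pow_le (/ 2) b).
    pose proof (pow_le (/ 2) (n - s)). destruct (Nat.leb _ _); lra. }
  induction n as [|n IH].
  - simpl rsum. destruct (Nat.leb_spec (s + b) 0) as [H|H]; [|lra].
    assert (s = 0 /\ b = 0)%nat as [-> ->] by lia. simpl. lra.
  - change (rsum (S n) ?f) with (rsum n f + f n). cbv beta.
    destruct (Nat.leb_spec (s + b) n) as [H|H];
      destruct (Nat.leb_spec (s + b) (S n)) as [H'|H']; try lia; [| |lra].
    + replace (S n - s)%nat with (S (n - s)) by lia. simpl pow. lra.
    + replace (S n - s)%nat with b by lia. lra.
Qed.

(* Within a window of length M the orbit of a small point doubles without wrapping around,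
   so the large terms are a geometric progression and trimming keeps only its tail. *)
Lemma trimmed_sum_le_cluster n b x M d Y :
  0 <= x < 1 -> 0 <= Y ->
  (forall k, (k < n)%nat -> 0 < orb k x /\ / orb k x <= Y) ->
  (forall k l, (k + l < n)%nat -> (M <= l)%nat ->
     orb k x < / 2 ^ M -> orb (k + l) x < / 2 ^ M -> False) ->
  ext_val (trimmed_sum n b x) <=
  (1 + / 2 ^ d) * rsum n (fun k => smooth (/ 2 ^ (M + d)) (orb k x)) + 2 * (/ 2) ^ b * Y.
Proof.
  intros Hx HY0 HY H2.
  assert (Hpd := pow2_pos d). assert (HpM := pow2_pos M).
  assert (Hid : 0 < / 2 ^ d) by now apply Rinv_0_lt_compat.
  assert (HiM : 0 < / 2 ^ M) by now apply Rinv_0_lt_compat.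
  (* [k0] is the first time below [/ 2 ^ M]. As no second run exists, every later small time is
     fewer than [M] steps away, and over such a distance the orbit has only doubled. *)
  assert (Hk0 : exists k0, forall k, (k < n)%nat -> orb k x < / 2 ^ M ->
            (k0 <= k)%nat /\ / orb k x <= (/ 2) ^ (k - k0) * Y).
  { destruct (first_below (fun k => orb k x) (/ 2 ^ M) n) as [H|(k0 & Hk0 & Hs & Hm)].
    - exists O. intros k Hk Hlt. specialize (H k Hk). lra.
    - exists k0. intros k Hk Hlt.
      assert (Hle : (k0 <= k)%nat).
      { destruct (le_lt_dec k0 k) as [|Hl]; [assumption|]. specialize (Hm k Hl). lra. }
      split; [assumption|]. set (l := (k - k0)%nat).
      assert (Ek : k = (k0 + l)%nat) by (unfold l; lia).
      assert (HlM : (l < M)%nat).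
      { destruct (le_lt_dec M l) as [Hl|]; [|assumption]. exfalso.
        apply (H2 k0 l); [lia|assumption|assumption|now rewrite <- Ek]. }
      destruct (HY k0 Hk0) as [Hpos HYk].
      rewrite Ek, orb_add, orb_no_wrap; [|lra|].
      + rewrite Rinv_mult, <- pow_inv. apply Rmult_le_compat_l; [|assumption].
        apply pow_le. lra.
      + apply Rlt_le_trans with (2 ^ l * / 2 ^ M).
        * apply Rmult_lt_compat_l; [apply pow2_pos|assumption].
        * apply Rmult_le_reg_r with (2 ^ M); [lra|].
          rewrite Rmult_assoc, Rinv_l, Rmult_1_l, Rmult_1_r by lra.
          apply Rle_pow; [lra|lia]. }
  destruct Hk0 as [k0 Hk0].
  eapply Rle_trans; [apply (trimmed_sum_le n b x k0); intros; now apply HY|].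
  apply Rle_trans with (rsum n (fun k => (1 + / 2 ^ d) * smooth (/ 2 ^ (M + d)) (orb k x) +
     Y * (if Nat.leb (k0 + b) k then (/ 2) ^ (k - k0) else 0))).
  - apply rsum_le. intros k Hk. destruct (HY k Hk) as [Hp _].
    set (t := / 2 ^ (M + d)).
    assert (Et : t = / 2 ^ d * / 2 ^ M) by (unfold t; rewrite pow_add, Rinv_mult; ring).
    assert (Ht : 0 < t) by (rewrite Et; now apply Rmult_lt_0_compat).
    assert (Hsm : 0 < smooth t (orb k x)) by (apply Rinv_0_lt_compat; lra).
    assert (HT : 0 <= Y * (if Nat.leb (k0 + b) k then (/ 2) ^ (k - k0) else 0)).
    { apply Rmult_le_pos; [lra|].
      destruct (Nat.leb _ _); [apply pow_le; lra|lra]. }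
    assert (HS : 0 <= (1 + / 2 ^ d) * smooth t (orb k x)) by (apply Rmult_le_pos; lra).
    destruct (in_block k0 b k) eqn:Eb; [lra|].
    (* A small point outside the removed block comes after it, hence belongs to the geometric tail.
       For a point [y >= / 2 ^ M] one has [t <= / 2 ^ d * y], so smoothing loses at most a factor
       [1 + / 2 ^ d]. *)
    destruct (Rlt_le_dec (orb k x) (/ 2 ^ M)) as [Hlt|Hge].
    + destruct (Hk0 k Hk Hlt) as [Hle Hinv].
      destruct (Nat.leb_spec (k0 + b) k) as [Hb|Hb]; [lra|].
      assert (in_block k0 b k = true) by (apply in_block_spec; lia). congruence.
    + enough (/ orb k x <= (1 + / 2 ^ d) * smooth t (orb k x)) by lra.
      unfold smooth. set (y := orb k x) in *.
      assert (Hty : t <= / 2 ^ d * y) by (rewrite Et; apply Rmult_le_compat_l; lra).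
      apply Rmult_le_reg_r with (y * (y + t)); [nra|].
      replace (/ y * (y * (y + t))) with (y + t) by (field; lra).
      replace ((1 + / 2 ^ d) * / (y + t) * (y * (y + t))) with (y + / 2 ^ d * y)
        by (field; lra). lra.
  - rewrite rsum_plus, !rsum_scal. apply Rplus_le_compat_l.
    rewrite (Rmult_comm _ Y). apply Rmult_le_compat_l; [assumption|].
    apply rsum_geometric_tail.
Qed.

(** * Truncation levels and exceptional sets *)

(** Quantities with exponents in quarters are compared through their fourth powers, which have
    integer exponents. *)
Lemma pow4_le_reg x y : 0 <= y -> x ^ 4 <= y ^ 4 -> x <= y.
Proof.
  intros Hy H. destruct (Rle_lt_dec x y) as [|Hlt]; [assumption|]. exfalso.
  assert (y ^ 2 < x ^ 2) by nra. assert (y ^ 4 < x ^ 4) by (simpl in *; nra). lra.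
Qed.

(* [2 ^ ht m] is the power of two closest to [m ^ (3/4)] from below. *)
Definition ht (m : nat) : nat := (Nat.log2 (m ^ 3) / 4)%nat.

Lemma ht_spec m : (1 <= m)%nat ->
  (2 ^ ht m) ^ 4 <= INR m ^ 3 < 16 * (2 ^ ht m) ^ 4.
Proof.
  intros Hm. assert (Hm3 : (0 < m ^ 3)%nat) by (simpl; nia).
  destruct (Nat.log2_spec _ Hm3) as [H1 H2]. unfold ht.
  set (L := Nat.log2 (m ^ 3)) in *.
  pose proof (Nat.div_mod_eq L 4) as HL. pose proof (Nat.mod_upper_bound L 4 ltac:(lia)).
  set (h := (L / 4)%nat) in *.
  rewrite <- pow_INR, <- !pow_mult.
  replace 16 with (2 ^ 4) by ring. rewrite <- pow_add, <- !INR_pow2. split.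
  - apply le_INR. eapply Nat.le_trans; [|exact H1]. apply Nat.pow_le_mono_r; lia.
  - apply lt_INR. eapply Nat.lt_le_trans; [exact H2|]. apply Nat.pow_le_mono_r; lia.
Qed.

(** The exponent is [3/4 - 2], from Chebyshev at deviation [n m] and truncation level
    [n m^(3/4)]. *)
Definition weight (m : nat) : R := Rpower (INR m) (- (5 / 4)).

Lemma weight_pos m : 0 < weight m.
Proof. apply exp_pos. Qed.

Lemma weight_pow4 m : (1 <= m)%nat -> weight m ^ 4 = / INR m ^ 5.
Proof.
  intros Hm. assert (0 < INR m) by (apply lt_0_INR; lia). unfold weight.
  rewrite <- Rpower_pow by apply exp_pos. rewrite Rpower_mult.
  replace (- (5 / 4) * INR 4) with (- INR 5) by (simpl; field).
  now rewrite Rpower_Ropp, Rpower_pow.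
Qed.

Lemma ht_div_sqr_le m : (1 <= m)%nat -> 2 ^ ht m / INR m ^ 2 <= weight m.
Proof.
  intros Hm. pose proof (ht_spec m Hm) as [H _].
  assert (Hm0 : 0 < INR m) by (apply lt_0_INR; lia).
  apply pow4_le_reg; [left; apply weight_pos|]. rewrite (weight_pow4 m Hm).
  set (a := INR m) in *.
  replace ((2 ^ ht m / a ^ 2) ^ 4) with ((2 ^ ht m) ^ 4 * / a ^ 8) by (field; lra).
  replace (/ a ^ 5) with (a ^ 3 * / a ^ 8) by (field; lra).
  apply Rmult_le_compat_r; [|assumption].
  left. apply Rinv_0_lt_compat, pow_lt; lra.
Qed.

(** Rounding down gives [2 ^ ht m > m^(3/4) / 2], hence a bound [4 m^(-3/2)]; it is weakened so that
    one summable weight serves both kinds of exceptional event. *)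
Lemma inv_ht_sqr_le m : (1 <= m)%nat -> (/ 2 ^ ht m) ^ 2 <= 4 * weight m.
Proof.
  intros Hm. pose proof (ht_spec m Hm) as [_ H].
  assert (Hm1 : 1 <= INR m) by (apply (le_INR 1); lia).
  pose proof (weight_pos m).
  apply pow4_le_reg; [lra|].
  rewrite Rpow_mult_distr, (weight_pow4 m Hm).
  pose proof (pow2_pos (ht m)) as HH.
  set (a := INR m) in *. set (u := 2 ^ ht m) in *.
  assert (Ha3 : 0 < a ^ 3) by (apply pow_lt; lra).
  assert (Hu4 : 0 < u ^ 4) by (apply pow_lt; lra).
  assert (H8 : a ^ 6 <= 256 * u ^ 8).
  { replace (a ^ 6) with (a ^ 3 * a ^ 3) by ring.
    replace (256 * u ^ 8) with ((16 * u ^ 4) * (16 * u ^ 4)) by ring.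
    apply Rmult_le_compat; lra. }
  assert (H5 : a ^ 5 <= a ^ 6) by (apply Rle_pow; [lra|lia]).
  assert (Ha5 : 0 < a ^ 5) by (apply pow_lt; lra).
  assert (Hu8 : 0 < u ^ 8) by (apply pow_lt; lra).
  replace (((/ u) ^ 2) ^ 4) with (/ u ^ 8) by (field; lra).
  apply Rmult_le_reg_r with (u ^ 8 * a ^ 5); [nra|].
  replace (/ u ^ 8 * (u ^ 8 * a ^ 5)) with (a ^ 5) by (field; lra).
  replace (4 ^ 4 * / a ^ 5 * (u ^ 8 * a ^ 5)) with (256 * u ^ 8) by (field; lra).
  lra.
Qed.

Lemma small_tails_scal c p : 0 <= c -> small_tails p -> small_tails (fun m => c * p m).
Proof.
  intros Hc Hp eps He. destruct (Hp (eps / (c + 1))) as [M HM].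
  { apply Rdiv_lt_0_compat; lra. }
  exists M. intros m Hm N. rewrite rsum_scal. specialize (HM m Hm N).
  apply Rle_trans with (c * (eps / (c + 1))); [apply Rmult_le_compat_l; lra|].
  apply Rmult_le_reg_r with (c + 1); [lra|].
  replace (c * (eps / (c + 1)) * (c + 1)) with (c * eps) by (field; lra). nra.
Qed.

(** Discrete form of integrating [u^(-5/4)] to [4 u^(-1/4)]: the ratio of [(a - 1)^(-1/4)] to
    [a^(-1/4)] is an exponential, at least [1 + 1 / (4 a)]. *)
Lemma weight_telescope a : 1 < a ->
  Rpower a (- (5 / 4)) <= 4 * (Rpower (a - 1) (- (1 / 4)) - Rpower a (- (1 / 4))).
Proof.
  intros Ha.
  assert (E : Rpower (a - 1) (- (1 / 4)) =
              Rpower a (- (1 / 4)) * exp (1 / 4 * (ln a - ln (a - 1)))).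
  { unfold Rpower. rewrite <- exp_plus. f_equal. ring. }
  assert (E2 : Rpower a (- (5 / 4)) = Rpower a (- (1 / 4)) * / a).
  { replace (- (5 / 4)) with (- (1 / 4) + - (1)) by field.
    rewrite Rpower_plus, (Rpower_Ropp a 1), Rpower_1 by lra. reflexivity. }
  pose proof (ln_step (a - 1) ltac:(lra)) as [H _].
  replace (a - 1 + 1) with a in H by ring.
  assert (0 < / a) by (apply Rinv_0_lt_compat; lra).
  assert (H1 : 1 + 1 / 4 * (ln a - ln (a - 1)) <= exp (1 / 4 * (ln a - ln (a - 1)))).
  { left. apply exp_ineq1. lra. }
  rewrite E, E2. assert (0 < Rpower a (- (1 / 4))) by apply exp_pos. nra.
Qed.

Lemma small_tails_weight : small_tails weight.
Proof.
  intros eps He.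
  set (g := fun a => 4 * Rpower a (- (1 / 4))).
  assert (T : forall m N, (2 <= m)%nat -> rsum N (fun k => weight (m + k)) <=
                          g (INR m - 1) - g (INR (m + N) - 1)).
  { intros m N Hm. induction N as [|N IH].
    - rewrite Nat.add_0_r. simpl. lra.
    - change (rsum (S N) ?f) with (rsum N f + f N). cbv beta.
      assert (2 <= INR (m + N)) by (apply (le_INR 2); lia).
      rewrite Nat.add_succ_r, S_INR.
      pose proof (weight_telescope (INR (m + N)) ltac:(lra)) as H0.
      unfold g in *. fold (weight (m + N)) in H0.
      replace (INR (m + N) + 1 - 1) with (INR (m + N)) by ring. lra. }
  destruct (INR_unbounded (Rpower (eps / 4) (- 4))) as [M HM].
  exists (M + 2)%nat. intros m Hm N.
  eapply Rle_trans; [apply T; lia|].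
  assert (0 < g (INR (m + N) - 1)).
  { apply Rmult_lt_0_compat; [lra|apply exp_pos]. }
  enough (g (INR m - 1) <= eps) by lra. unfold g.
  enough (Rpower (INR m - 1) (- (1 / 4)) <= eps / 4) by lra.
  assert (HM1 : Rpower (eps / 4) (- 4) <= INR m - 1).
  { assert (INR (M + 2) <= INR m) by now apply le_INR.
    rewrite plus_INR in H0. simpl (INR 2) in H0. lra. }
  replace (eps / 4) with (Rpower (Rpower (eps / 4) (- 4)) (- (1 / 4))) at 1.
  - rewrite !Rpower_Ropp. apply Rinv_le_contravar; [apply exp_pos|].
    apply Rle_Rpower_l; [lra|]. split; [apply exp_pos|exact HM1].
  - rewrite Rpower_mult. replace (-4 * - (1 / 4)) with 1 by field.
    apply Rpower_1. lra.
Qed.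

Lemma small_tails_Psi psi : in_Psi psi -> small_tails (fun q => / psi q).
Proof.
  intros [_ [l Hl]] eps He. destruct (Hl (eps / 2)) as [M HM]; [lra|].
  exists (M + 2)%nat. intros m Hm N.
  assert (E : rsum N (fun k => / psi (m + k)%nat) =
    rsum (m - 1 + N) (fun k => / psi (S k)) - rsum (m - 1) (fun k => / psi (S k))).
  { rewrite rsum_app.
    rewrite (rsum_ext N (fun k => / psi (S (m - 1 + k))) (fun k => / psi (m + k)%nat)).
    - ring.
    - intros k _. do 2 f_equal. lia. }
  rewrite E.
  assert (H1 := HM (m - 2 + N)%nat ltac:(lia)). assert (H2 := HM (m - 2)%nat ltac:(lia)).
  rewrite sum_f_R0_rsum in H1, H2. unfold Rdist in H1, H2.
  replace (S (m - 2 + N)) with (m - 1 + N)%nat in H1 by lia.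
  replace (S (m - 2)) with (m - 1)%nat in H2 by lia.
  apply Rabs_def2 in H1, H2. lra.
Qed.

(** The deviation allowed is a fraction [1 / P] of [n m], plus the slack of
    [outer_le_smooth_deviation]. The smoothing is [P] binary digits finer than the run threshold
    [/ 2 ^ (m + ht m)], which makes its relative cost [/ 2 ^ P]. *)
Definition deviation (P m i : nat) (x : R) : Prop :=
  INR (i * 2 ^ m) * (INR m / INR P) + 3 * INR (i * 2 ^ m) <=
  Rabs (rsum (i * 2 ^ m) (fun k => smooth (/ 2 ^ (m + ht m + P)) (orb k x)) -
        INR (i * 2 ^ m) * ln (2 ^ (m + ht m + P))).

Definition two_clusters (m i : nat) (x : R) : Prop :=
  exists k l, (k + l < i * 2 ^ m)%nat /\ (m + ht m <= l)%nat /\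
    orb k x < / 2 ^ (m + ht m) /\ orb (k + l) x < / 2 ^ (m + ht m).

(** An [n] is enclosed between [i 2^m] and [(i + 1) 2^m] with [P <= i < 2 P], so the grid index has
    to reach [2 P]. *)
Definition bad_block (P m : nat) (x : R) : Prop :=
  0 <= x < 1 /\ exists i, (1 <= i < 2 * P + 1)%nat /\ (deviation P m i x \/ two_clusters m i x).

Lemma outer_le_deviation P m i : (1 <= P)%nat -> (1 <= m)%nat -> (1 <= i)%nat ->
  outer_le (fun x => 0 <= x < 1 /\ deviation P m i x)
           (32 * 2 ^ P * INR P ^ 2 * weight m).
Proof.
  intros HP Hm Hi. set (t := / 2 ^ (m + ht m + P)).
  assert (Hp := pow2_pos (m + ht m + P)).
  assert (Hp1 : 1 <= 2 ^ (m + ht m + P)) by (apply pow_R1_Rle; lra).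
  assert (Ht : 0 < t <= 1).
  { split; [now apply Rinv_0_lt_compat|]. rewrite <- Rinv_1.
    apply Rinv_le_contravar; lra. }
  assert (HP0 : 0 < INR P) by (apply lt_0_INR; lia).
  assert (Hm0 : 0 < INR m) by (apply lt_0_INR; lia).
  assert (Hi1 : 1 <= INR i) by (apply (le_INR 1); lia).
  assert (H2m := pow2_pos m). assert (H2h := pow2_pos (ht m)). assert (H2P := pow2_pos P).
  assert (En : INR (i * 2 ^ m) = INR i * 2 ^ m) by now rewrite mult_INR, INR_pow2.
  assert (Hn : 0 < INR (i * 2 ^ m)) by (rewrite En; nra).
  set (c := INR (i * 2 ^ m) * (INR m / INR P)).
  assert (Hc : 0 < c) by (apply Rmult_lt_0_compat; [lra|apply Rdiv_lt_0_compat; lra]).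
  apply outer_le_weaken with (3 := outer_le_smooth_deviation t (i * 2 ^ m) c Ht Hc).
  - intros x [Hx Hd]. split; [assumption|]. unfold deviation in Hd. fold t c in Hd.
    unfold t at 2. rewrite Rinv_inv. exact Hd.
  - unfold c, t. rewrite En, !pow_add.
    replace (32 * (INR i * 2 ^ m) /
       (/ (2 ^ m * 2 ^ ht m * 2 ^ P) * (INR i * 2 ^ m * (INR m / INR P)) ^ 2))
      with (32 * 2 ^ P * INR P ^ 2 * (2 ^ ht m / INR m ^ 2 * / INR i)) by (field; lra).
    apply Rmult_le_compat_l.
    + apply Rmult_le_pos; [lra|apply pow2_ge_0].
    + pose proof (ht_div_sqr_le m Hm).
      assert (0 <= 2 ^ ht m / INR m ^ 2) by (apply Rle_mult_inv_pos; [lra|apply pow_lt; lra]).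
      assert (/ INR i <= 1) by (rewrite <- Rinv_1; apply Rinv_le_contravar; lra).
      assert (0 < / INR i) by (apply Rinv_0_lt_compat; lra). nra.
Qed.

Lemma outer_le_two_clusters_block P m i : (1 <= m)%nat -> (i < 2 * P + 1)%nat ->
  outer_le (fun x => 0 <= x < 1 /\ two_clusters m i x)
           (8 * INR (2 * P + 1) ^ 2 * weight m).
Proof.
  intros Hm Hi.
  apply outer_le_weaken with (3 := outer_le_two_clusters (i * 2 ^ m) (m + ht m)); [auto|].
  assert (H2m := pow2_pos m). assert (H2h := pow2_pos (ht m)).
  rewrite mult_INR, INR_pow2, pow_add.
  replace ((INR i * 2 ^ m) ^ 2 * (2 * (/ (2 ^ m * 2 ^ ht m)) ^ 2))
    with (INR i ^ 2 * (2 * (/ 2 ^ ht m) ^ 2)) by (field; lra).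
  pose proof (inv_ht_sqr_le m Hm).
  replace (8 * INR (2 * P + 1) ^ 2 * weight m)
    with (INR (2 * P + 1) ^ 2 * (2 * (4 * weight m))) by ring.
  apply Rmult_le_compat.
  - apply pow2_ge_0.
  - pose proof (pow2_ge_0 (/ 2 ^ ht m)). lra.
  - apply pow_incr. split; [apply pos_INR|]. apply le_INR. lia.
  - lra.
Qed.

Lemma null_bad_block P : (1 <= P)%nat ->
  null (fun x => forall M, exists m, (M <= m)%nat /\ bad_block P m x).
Proof.
  intros HP.
  set (c := INR (2 * P + 1) * (32 * 2 ^ P * INR P ^ 2 + 8 * INR (2 * P + 1) ^ 2)).
  assert (Hc0 : 0 <= 32 * 2 ^ P * INR P ^ 2 + 8 * INR (2 * P + 1) ^ 2).
  { pose proof (pow2_pos P). pose proof (pow2_ge_0 (INR P)).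
    pose proof (pow2_ge_0 (INR (2 * P + 1))).
    assert (0 <= 2 ^ P * INR P ^ 2) by (apply Rmult_le_pos; lra). lra. }
  apply borel_cantelli with (m0 := 1%nat) (p := fun m => c * weight m).
  2:{ apply small_tails_scal, small_tails_weight.
      apply Rmult_le_pos; [apply pos_INR|assumption]. }
  intros m Hm.
  apply outer_le_weaken with
    (E := fun x => exists i, (i < 2 * P + 1)%nat /\
       ((1 <= i)%nat /\ ((0 <= x < 1 /\ deviation P m i x) \/
                         (0 <= x < 1 /\ two_clusters m i x))))
    (p := rsum (2 * P + 1) (fun _ => 32 * 2 ^ P * INR P ^ 2 * weight m +
                                     8 * INR (2 * P + 1) ^ 2 * weight m)).
  - intros x (Hx & i & Hi & H). exists i. split; [lia|]. split; [lia|]. tauto.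
  - rewrite rsum_const. unfold c. apply Req_le. ring.
  - apply (outer_le_finite_union (2 * P + 1) (fun i x =>
       (1 <= i)%nat /\ ((0 <= x < 1 /\ deviation P m i x) \/
                        (0 <= x < 1 /\ two_clusters m i x)))).
    intros i Hi. destruct (le_lt_dec 1 i) as [H1|H1].
    + apply outer_le_weaken with
        (3 := outer_le_union _ _ _ _ (outer_le_deviation P m i HP Hm H1)
                                     (outer_le_two_clusters_block P m i Hm Hi)).
      * tauto.
      * lra.
    + apply outer_le_empty; [intros x [? _]; lia|].
      rewrite <- Rmult_plus_distr_r. apply Rmult_le_pos; [assumption|].
      left; apply weight_pos.
Qed.

(** The times below [exp (q + 1)] include those below any [n] whose logarithm has floor [q]. The
    factor [2 * INR P] compensates the factor 2 lost in [pow2_bseq_ge] and leaves a fraction [1 / P]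
    of [n L] for the trimmed run. *)
Definition bad_size (psi : nat -> R) (P q : nat) (x : R) : Prop :=
  0 <= x < 1 /\ exists k, INR k < exp (INR q + 1) /\
    orb k x < 2 * INR P / (exp (INR q) * psi q).

Lemma null_bad_size psi P : in_Psi psi ->
  null (fun x => forall M, exists q, (M <= q)%nat /\ bad_size psi P q x).
Proof.
  intros Hpsi. pose proof (pos_INR P) as HP.
  assert (He1 : 0 < exp 1) by apply exp_pos.
  apply borel_cantelli with (m0 := 1%nat) (p := fun q => 8 * exp 1 * INR P * / psi q).
  2:{ apply small_tails_scal, small_tails_Psi; [nra|assumption]. }
  intros q Hq. destruct Hpsi as [Hpos _]. specialize (Hpos q Hq).
  assert (Heq : 0 < exp (INR q)) by apply exp_pos.
  set (s := 2 * INR P / (exp (INR q) * psi q)).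
  assert (Hs : 0 <= s) by (apply Rle_mult_inv_pos; [lra|now apply Rmult_lt_0_compat]).
  (* The factor [exp (q + 1)] from the number of times cancels [exp q] in the threshold up to
     [exp 1], leaving a multiple of [/ psi q]. *)
  set (K := Z.to_nat (up (exp (INR q + 1)))).
  assert (Hexp : 1 <= exp (INR q + 1)).
  { rewrite <- exp_0 at 1. left. apply exp_increasing. pose proof (pos_INR q). lra. }
  destruct (archimed (exp (INR q + 1))) as [Hu1 Hu2].
  assert (HK : exp (INR q + 1) < INR K <= 2 * exp (INR q + 1)).
  { unfold K. rewrite (INR_IZR_INZ (Z.to_nat _)), Z2Nat.id; [lra|]. apply le_IZR. lra. }
  apply outer_le_weaken with (3 := outer_le_any_small K s Hs).
  - intros x (Hx & k & Hk & H). split; [assumption|]. exists k.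
    split; [apply INR_lt; lra|assumption].
  - apply Rle_trans with (2 * exp (INR q + 1) * (2 * s)).
    + apply Rmult_le_compat_r; lra.
    + unfold s. rewrite exp_plus. apply Req_le. field. lra.
Qed.

(** * Deterministic estimates off the exceptional sets *)

Lemma ln2_bounds : 1 / 2 <= ln 2 <= 1.
Proof.
  pose proof (ln_step 1 ltac:(lra)) as H. rewrite ln_1 in H.
  replace (1 + 1) with 2 in H by ring. lra.
Qed.

Lemma ln_pow2 k : ln (2 ^ k) = INR k * ln 2.
Proof. rewrite <- Rpower_pow by lra. unfold Rpower. apply ln_exp. Qed.

Lemma INR_lt_pow2 k : INR k < 2 ^ k.
Proof. rewrite <- INR_pow2. apply lt_INR, Nat.pow_gt_lin_r. lia. Qed.

(** Smoothed sums increase in [n], so control at the two neighbouring grid points suffices; these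
    differ by a factor at most [1 + e] because [i >= P]. *)
Lemma block_estimate (P m i n b : nat) (x L Y : R) :
  let e := / INR P in
  (2 <= P)%nat -> (P <= i < 2 * P)%nat -> (i * 2 ^ m <= n < (i + 1) * 2 ^ m)%nat ->
  0 <= x < 1 -> ~ bad_block P m x ->
  (forall k, (k < n)%nat -> 0 < orb k x /\ / orb k x <= Y) ->
  0 <= Y -> (/ 2) ^ b * Y <= e * (INR n * L) ->
  0 < L -> (1 - e) * L <= INR m * ln 2 <= L ->
  INR (ht m + P) * ln 2 + 3 <= e * INR m ->
  INR b * 2 ^ (m + ht m + P) <= e * (INR n * L) -> 1 <= e * L ->
  Rabs (ext_val (trimmed_sum n b x) - INR n * L) <= 20 * e * (INR n * L).
Proof.
  intros e HP Hi Hn Hx Hbad HY HY0 HbY HL HmL Hh Hb He1.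
  assert (HP2 : 2 <= INR P) by (apply (le_INR 2); lia).
  assert (He : 0 < e <= 1 / 2).
  { split; [apply Rinv_0_lt_compat; lra|]. unfold e.
    replace (1 / 2) with (/ 2) by field. apply Rinv_le_contravar; lra. }
  assert (HeP : e * INR P = 1) by (unfold e; field; lra).
  assert (H2m := pow2_pos m).
  assert (Hn1 : INR i * 2 ^ m <= INR n).
  { rewrite <- INR_pow2, <- mult_INR. apply le_INR. lia. }
  assert (Hn2 : INR n < (INR i + 1) * 2 ^ m).
  { rewrite <- INR_pow2, <- S_INR, <- mult_INR. apply lt_INR. lia. }
  assert (HiP : INR P <= INR i) by (apply le_INR; lia).
  assert (Hen : 2 ^ m <= e * INR n).
  { apply Rmult_le_reg_r with (INR P); [lra|].
    replace (e * INR n * INR P) with (e * INR P * INR n) by ring. rewrite HeP. nra. }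
  set (N := INR n) in *.
  assert (HN : 0 < N) by nra.
  set (T := fun j => rsum j (fun k => smooth (/ 2 ^ (m + ht m + P)) (orb k x))).
  set (t := / 2 ^ (m + ht m + P)) in *.
  assert (Hpt := pow2_pos (m + ht m + P)).
  assert (Ht : 0 < t) by now apply Rinv_0_lt_compat.
  assert (Hsm : forall k, 0 <= smooth t (orb k x)).
  { intros k. left. apply Rinv_0_lt_compat. pose proof (orb_range k x Hx). lra. }
  assert (Hln : ln (2 ^ (m + ht m + P)) = INR m * ln 2 + INR (ht m + P) * ln 2).
  { rewrite ln_pow2, !plus_INR. ring. }
  assert (Hdev : forall j, (1 <= j < 2 * P + 1)%nat ->
    Rabs (T (j * 2 ^ m)%nat - INR j * 2 ^ m * ln (2 ^ (m + ht m + P))) <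
    INR j * 2 ^ m * (INR m * e) + 3 * (INR j * 2 ^ m)).
  { intros j Hj. apply Rnot_le_lt. intros H. apply Hbad. split; [assumption|].
    exists j. split; [assumption|]. left. unfold deviation. fold t.
    rewrite mult_INR, INR_pow2. exact H. }
  assert (HD1 := Hdev i ltac:(lia)). assert (HD2 := Hdev (i + 1)%nat ltac:(lia)).
  rewrite (plus_INR i 1), INR_1 in HD2.
  apply Rabs_def2 in HD1, HD2. destruct HD1 as [_ HD1]. destruct HD2 as [HD2 _].
  rewrite Hln in HD1, HD2.
  assert (HT1 : T (i * 2 ^ m)%nat <= T n) by (apply rsum_mono_n; [lia|exact Hsm]).
  assert (HT2 : T n <= T ((i + 1) * 2 ^ m)%nat) by (apply rsum_mono_n; [lia|exact Hsm]).
  pose proof ln2_bounds as Hl2. pose proof (pos_INR (ht m + P)) as HhP.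
  assert (HmL2 : INR m <= 2 * L).
  { pose proof (pos_INR m). nra. }
  assert (HNL : 0 < N * L) by now apply Rmult_lt_0_compat.
  set (w := INR (ht m + P) * ln 2) in *.
  assert (Hw : 0 <= w) by (apply Rmult_le_pos; lra).
  assert (Hem : e * INR m <= 2 * e * L) by nra.
  assert (HA1 : INR i * 2 ^ m * (w + 3) <= INR i * 2 ^ m * (e * INR m))
    by (apply Rmult_le_compat_l; [nra|assumption]).
  assert (HA2 : (INR i + 1) * 2 ^ m * (w + 3) <= (INR i + 1) * 2 ^ m * (e * INR m))
    by (apply Rmult_le_compat_l; [nra|assumption]).
  assert (HA3 : 0 <= INR i * 2 ^ m * w) by (apply Rmult_le_pos; [nra|assumption]).
  assert (Low : (1 - 7 * e) * (N * L) <= T n).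
  { apply Rle_trans with (INR i * 2 ^ m * (INR m * ln 2 - 2 * (e * INR m))); [|lra].
    assert (Hni : (1 - e) * N <= INR i * 2 ^ m) by nra.
    assert (Hq : (1 - 5 * e) * L <= INR m * ln 2 - 2 * (e * INR m)) by lra.
    apply Rle_trans with (INR i * 2 ^ m * ((1 - 5 * e) * L)).
    (* For [P < 5] the factor [1 - 5 * e] is negative, and [INR i * 2 ^ m] must then be bounded from
       above, by [N]. *)
    - destruct (Rle_lt_dec 0 (1 - 5 * e)) as [H5|H5].
      + apply Rle_trans with ((1 - e) * N * ((1 - 5 * e) * L)).
        * replace ((1 - e) * N * ((1 - 5 * e) * L)) with ((1 - e) * (1 - 5 * e) * (N * L)) by ring.
          apply Rmult_le_compat_r; [lra|nra].
        * apply Rmult_le_compat_r; [nra|assumption].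
      + apply Rle_trans with (N * ((1 - 5 * e) * L)).
        * replace (N * ((1 - 5 * e) * L)) with ((1 - 5 * e) * (N * L)) by ring.
          apply Rmult_le_compat_r; lra.
        * assert ((1 - 5 * e) * L <= 0) by nra. nra.
    - apply Rmult_le_compat_l; [nra|assumption]. }
  assert (Up : T n <= (1 + e) * ((1 + 4 * e) * (N * L))).
  { apply Rle_trans with ((INR i + 1) * 2 ^ m * (INR m * ln 2 + 2 * (e * INR m))); [lra|].
    assert (Hni : (INR i + 1) * 2 ^ m <= (1 + e) * N) by nra.
    replace ((1 + e) * ((1 + 4 * e) * (N * L))) with ((1 + e) * N * ((1 + 4 * e) * L)) by ring.
    pose proof (pos_INR m). apply Rmult_le_compat; [nra|nra|assumption|lra]. }
  assert (Hlow : T n - N - INR b * 2 ^ (m + ht m + P) <= ext_val (trimmed_sum n b x)).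
  { eapply Rle_trans; [|apply (trimmed_sum_ge n b x (2 ^ (m + ht m + P)));
                        [lra|intros; now apply HY]].
    (* The loss of 1 per term pays for the floor in [chi]; the cap is [/ t], which no smoothed term
       exceeds. *)
    apply Rplus_le_compat_r.
    replace (T n - N) with (rsum n (fun k => smooth t (orb k x) - 1)).
    2:{ unfold T. rewrite rsum_minus, rsum_const. unfold N. ring. }
    apply rsum_le. intros k Hk. destruct (HY k Hk) as [Hk0 _].
    apply Rmin_glb.
    - apply Rplus_le_compat_r. apply Rinv_le_contravar; lra.
    - assert (smooth t (orb k x) <= / t) by (apply Rinv_le_contravar; lra).
      unfold t in H at 2. rewrite Rinv_inv in H. lra. }
  assert (Hup : ext_val (trimmed_sum n b x) <= (1 + e) * T n + 2 * (e * (N * L))).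
  { eapply Rle_trans; [apply (trimmed_sum_le_cluster n b x (m + ht m) P Y Hx HY0 HY)|].
    - intros k l Hkl Hl H1 H2. apply Hbad. split; [assumption|].
      (* Runs up to time [n] are excluded through the upper grid point, since [n < (i + 1) 2^m]. *)
      exists (i + 1)%nat. split; [lia|]. right. exists k, l. repeat split; auto. lia.
    - apply Rplus_le_compat; [|lra]. fold t.
      apply Rmult_le_compat_r; [now apply rsum_nonneg|].
      apply Rplus_le_compat_l. unfold e. apply Rinv_le_contravar; [lra|].
      left. apply INR_lt_pow2. }
  assert (HN1 : N <= e * (N * L)).
  { replace (e * (N * L)) with (N * (e * L)) by ring. nra. }
  (* This linearises [(1 + e)^2 (1 + 4 e) + 2 e] to less than [1 + 20 e]; the lower bound amounts to
     [1 - 9 e]. *)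
  assert (Hee : e * e <= e / 2) by nra.
  assert (Hup2 : ext_val (trimmed_sum n b x) <= (1 + 20 * e) * (N * L)).
  { eapply Rle_trans; [exact Hup|].
    apply Rle_trans with (((1 + e) * (1 + e) * (1 + 4 * e) + 2 * e) * (N * L)).
    - assert ((1 + e) * T n <= (1 + e) * ((1 + e) * ((1 + 4 * e) * (N * L))))
        by (apply Rmult_le_compat_l; lra). lra.
    - apply Rmult_le_compat_r; [lra|]. nra. }
  apply Rabs_le. nra.
Qed.

(** The logarithm of [n / P] selects the scale at which [n] lies between [P 2^m] and [2 P 2^m]. *)
Lemma dyadic_block P n : (1 <= P)%nat -> (P <= n)%nat ->
  let m := Nat.log2 (n / P) in let i := (n / 2 ^ m)%nat in
  (P <= i < 2 * P)%nat /\ (i * 2 ^ m <= n < (i + 1) * 2 ^ m)%nat.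
Proof.
  intros HP Hn m i.
  assert (H0 : (0 < n / P)%nat) by (apply Nat.div_str_pos; lia).
  destruct (Nat.log2_spec _ H0) as [H1 H2]. fold m in H1, H2.
  pose proof (Nat.pow_nonzero 2 m ltac:(lia)) as Hp.
  pose proof (Nat.div_mod_eq n P) as E1. pose proof (Nat.mod_upper_bound n P ltac:(lia)).
  pose proof (Nat.div_mod_eq n (2 ^ m)) as E2. pose proof (Nat.mod_upper_bound n (2 ^ m) Hp).
  fold i in E2. rewrite Nat.pow_succ_r' in H2. set (V := (2 ^ m)%nat) in *.
  set (D := (n / P)%nat) in *. repeat split; nia.
Qed.

Lemma log2_div_large P K : (1 <= P)%nat ->
  forall n, (P * 2 ^ K <= n)%nat -> (K <= Nat.log2 (n / P))%nat.
Proof.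
  intros HP n Hn. rewrite <- (Nat.log2_pow2 K) by lia. apply Nat.log2_le_mono.
  apply Nat.div_le_lower_bound; lia.
Qed.

(** The crude [h < 2 ^ h] gives [ht m <= m^(3/4)], and [m^(1/4) >= 2 P] does the rest. *)
Lemma ht_small P m : (1 <= P)%nat -> 16 * INR P ^ 4 <= INR m -> INR (ht m) <= INR m / (2 * INR P).
Proof.
  intros HP H. assert (HP1 : 1 <= INR P) by (apply (le_INR 1); lia).
  assert (HP4 : 1 <= INR P ^ 4) by (apply pow_R1_Rle; lra).
  assert (Hm : (1 <= m)%nat) by (apply INR_le; simpl; lra).
  destruct (ht_spec m Hm) as [H3 _].
  apply pow4_le_reg; [apply Rle_mult_inv_pos; lra|].
  apply Rle_trans with (INR m ^ 3).
  - eapply Rle_trans; [|exact H3]. apply pow_incr. split; [apply pos_INR|].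
    left. apply INR_lt_pow2.
  - set (p := INR P) in *. set (a := INR m) in *.
    replace ((a / (2 * p)) ^ 4) with (a ^ 3 * (a / (16 * p ^ 4))) by (field; lra).
    rewrite <- (Rmult_1_r (a ^ 3)) at 1.
    apply Rmult_le_compat_l; [apply pow_le; lra|].
    apply Rmult_le_reg_r with (16 * p ^ 4); [lra|].
    replace (a / (16 * p ^ 4) * (16 * p ^ 4)) with a by (field; lra). lra.
Qed.

Lemma floor_nat L : 0 <= L ->
  INR (Z.to_nat (rfloor L)) <= L < INR (Z.to_nat (rfloor L)) + 1.
Proof.
  intros HL. unfold rfloor. destruct (base_Int_part L) as [H1 H2].
  assert (0 <= Int_part L)%Z.
  { assert (-1 < Int_part L)%Z by (apply lt_IZR; simpl; lra). lia. }
  rewrite INR_IZR_INZ, Z2Nat.id by assumption. lra.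
Qed.

Lemma INR_to_nat_ge z : IZR z <= INR (Z.to_nat z).
Proof. rewrite INR_IZR_INZ. apply IZR_le. lia. Qed.

(** Without the floor, [2^(b_n)] would be [psi q / L]; the floor loses at most a factor 2, and
    replacing a negative [b_n] by 0 only enlarges the power. *)
Lemma pow2_bseq_ge psi n :
  let q := Z.to_nat (rfloor (ln (INR n))) in
  0 < ln (INR n) -> 0 < psi q ->
  psi q <= 2 * ln (INR n) * 2 ^ Z.to_nat (bseq psi n).
Proof.
  intros q HL Hq. set (L := ln (INR n)) in *.
  set (v := (ln (psi q) - ln L) / ln 2).
  pose proof ln2_bounds as Hl2.
  assert (Hb : v - 1 <= INR (Z.to_nat (bseq psi n))).
  { eapply Rle_trans; [|apply INR_to_nat_ge]. unfold bseq. fold L. fold q. fold v. unfold rfloor.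
    destruct (base_Int_part v). lra. }
  rewrite <- Rpower_pow by lra.
  assert (E : psi q = 2 * L * exp ((v - 1) * ln 2)).
  { replace ((v - 1) * ln 2) with (ln (psi q) + (- ln L + - ln 2)) by (unfold v; field; lra).
    rewrite !exp_plus, !exp_Ropp, !exp_ln by lra. field. lra. }
  rewrite E at 1. apply Rmult_le_compat_l; [lra|].
  unfold Rpower. set (u := INR (Z.to_nat (bseq psi n))) in *.
  destruct (Req_dec ((v - 1) * ln 2) (u * ln 2)) as [->|Hne]; [lra|].
  left. apply exp_increasing. nra.
Qed.

(** Here the exponents 1/4 and 3/4 meet: [b] is at most a small multiple of [L^(1/4)] and [2 ^ ht m]
    at most [(2 L)^(3/4)]. The multiple is chosen to cancel [2 ^ P] and leave [1 / P]. *)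
Lemma trimming_negligible P m b L : (1 <= P)%nat -> (1 <= m)%nat -> 0 < L -> INR m <= 2 * L ->
  INR b <= / (2 * INR P * 2 ^ P) * Rpower L (1 / 4) ->
  INR b * 2 ^ ht m * 2 ^ P <= / INR P * L.
Proof.
  intros HP Hm HL HmL Hb. destruct (ht_spec m Hm) as [H _].
  assert (HP1 : 1 <= INR P) by (apply (le_INR 1); lia).
  pose proof (pow2_pos P) as H2P. pose proof (pow2_pos (ht m)) as Hht.
  set (eta := / (2 * INR P * 2 ^ P)) in *.
  assert (Heta : 0 < eta) by (apply Rinv_0_lt_compat; nra).
  assert (Hr4 : Rpower L (1 / 4) ^ 4 = L).
  { rewrite <- Rpower_pow by apply exp_pos. rewrite Rpower_mult.
    replace (1 / 4 * INR 4) with 1 by (simpl; field). now apply Rpower_1. }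
  set (r := Rpower L (1 / 4)) in *.
  enough (INR b * 2 ^ ht m <= 2 * eta * L) as H1.
  { apply Rle_trans with (2 * eta * L * 2 ^ P); [apply Rmult_le_compat_r; lra|].
    apply Req_le. unfold eta. field. lra. }
  apply pow4_le_reg; [nra|]. rewrite Rpow_mult_distr.
  assert (Hb4 : INR b ^ 4 <= eta ^ 4 * L).
  { rewrite <- Hr4, <- Rpow_mult_distr. apply pow_incr. split; [apply pos_INR|assumption]. }
  assert (Hm3 : INR m ^ 3 <= 8 * L ^ 3).
  { replace (8 * L ^ 3) with ((2 * L) ^ 3) by ring. apply pow_incr.
    split; [apply pos_INR|assumption]. }
  assert (HL3 : 0 < L ^ 3) by (apply pow_lt; lra).
  assert (He4 : 0 < eta ^ 4) by (apply pow_lt; lra).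
  apply Rle_trans with (eta ^ 4 * L * (8 * L ^ 3)).
  - apply Rmult_le_compat; [apply pow_le, pos_INR|apply pow_le; lra|assumption|lra].
  - replace (eta ^ 4 * L * (8 * L ^ 3)) with (8 * (eta ^ 4 * (L * L ^ 3))) by ring.
    replace ((2 * eta * L) ^ 4) with (16 * (eta ^ 4 * (L * L ^ 3))) by ring.
    assert (0 < eta ^ 4 * (L * L ^ 3)) by (repeat apply Rmult_lt_0_compat; lra). lra.
Qed.

Lemma trimmed_sum_close psi x P : in_Psi psi ->
  Un_cv (fun n => IZR (bseq psi n) / Rpower (ln (INR n)) (1 / 4)) 0 ->
  0 <= x < 1 -> (2 <= P)%nat ->
  (exists M, forall m, (M <= m)%nat -> ~ bad_block P m x) ->
  (exists M, forall q, (M <= q)%nat -> ~ bad_size psi P q x) ->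
  exists n0, forall n, (n0 <= n)%nat ->
    0 < INR n * ln (INR n) /\
    trimmed_sum n (Z.to_nat (bseq psi n)) x <> None /\
    Rabs (ext_val (trimmed_sum n (Z.to_nat (bseq psi n)) x) - INR n * ln (INR n))
      <= 20 * / INR P * (INR n * ln (INR n)).
Proof.
  intros Hpsi Hb Hx HP [M1 HM1] [M2 HM2].
  assert (HP2 : 2 <= INR P) by (apply (le_INR 2); lia).
  set (e := / INR P).
  assert (HeP : e * INR P = 1) by (unfold e; field; lra).
  assert (He : 0 < e <= 1 / 2).
  { split; [apply Rinv_0_lt_compat; lra|]. unfold e.
    replace (1 / 2) with (/ 2) by field. apply Rinv_le_contravar; lra. }
  pose proof (pow2_pos P) as H2P. pose proof ln2_bounds as Hl2.
  set (eta := / (2 * INR P * 2 ^ P)).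
  assert (Heta : 0 < eta) by (apply Rinv_0_lt_compat; nra).
  destruct (Hb eta Heta) as [M3 HM3].
  (* Since [m <= 2 L], the summands serve in turn: [ht_small]; the bound on [ht m + P];
     [ln P + 1 <= e L]; [1 <= e L]; [q >= M2]; and [q >= 1]. *)
  destruct (INR_unbounded (16 * INR P ^ 4 + 2 * INR P * (INR P + 3) +
     2 * INR P * (ln (INR P) + 1) + 2 * INR P + 2 * INR M2 + 4)) as [K0 HK0].
  exists (P * 2 ^ (M1 + K0 + 1) + M3 + P)%nat. intros n Hn.
  set (m := Nat.log2 (n / P)).
  assert (HmK : (M1 + K0 + 1 <= m)%nat) by (apply log2_div_large; lia).
  destruct (dyadic_block P n ltac:(lia) ltac:(lia)) as [Hi Hin]. fold m in Hi, Hin.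
  set (i := (n / 2 ^ m)%nat) in *.
  assert (HP4 : 0 <= INR P ^ 4) by (apply pow_le; lra).
  assert (HlnP : 0 <= ln (INR P)).
  { left. rewrite <- ln_1. apply ln_increasing; lra. }
  assert (HM20 := pos_INR M2).
  assert (HmR : INR K0 + 1 <= INR m) by (rewrite <- S_INR; apply le_INR; lia).
  assert (Hs1 : 0 <= INR P * (INR P + 3)) by nra.
  assert (Hs2 : 0 <= INR P * (ln (INR P) + 1)) by nra.
  assert (H2m := pow2_pos m).
  assert (Hn1 : INR P * 2 ^ m <= INR n).
  { rewrite <- INR_pow2, <- mult_INR. apply le_INR. nia. }
  assert (Hn2 : INR n <= INR P * 2 ^ S m).
  { rewrite <- INR_pow2, <- mult_INR. apply le_INR. rewrite Nat.pow_succ_r'. nia. }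
  assert (Hn0 : 0 < INR n) by nra.
  set (L := ln (INR n)) in *.
  assert (HL1 : INR m * ln 2 <= L).
  { rewrite <- ln_pow2. left. apply ln_increasing; [assumption|nra]. }
  assert (HL2 : L <= ln (INR P) + (INR m + 1) * ln 2).
  { rewrite <- S_INR, <- ln_pow2, <- ln_mult by (try apply pow2_pos; lra).
    unfold L. destruct Hn2 as [Hn2|<-]; [left; now apply ln_increasing|lra]. }
  assert (HmL : INR m <= 2 * L) by nra.
  assert (HL : 0 < L) by lra.
  assert (HNL : 0 < INR n * L) by now apply Rmult_lt_0_compat.
  split; [exact HNL|].
  set (q := Z.to_nat (rfloor L)).
  assert (Hq := floor_nat L ltac:(lra)). fold q in Hq.
  assert (HqM : (M2 <= q)%nat /\ (1 <= q)%nat).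
  { assert (INR M2 < INR (S q)) by (rewrite S_INR; lra).
    assert (INR 1 < INR (S q)) by (rewrite (S_INR q), INR_1; lra).
    apply INR_lt in H, H0. lia. }
  assert (HEL : exp L = INR n) by now apply exp_ln.
  assert (Hpq : 0 < psi q) by (apply Hpsi; lia).
  set (b := Z.to_nat (bseq psi n)).
  assert (H2b : psi q <= 2 * L * 2 ^ b) by now apply pow2_bseq_ge.
  assert (Heq0 : 0 < exp (INR q)) by apply exp_pos.
  assert (HEq : exp (INR q) <= INR n < exp (INR q + 1)).
  { rewrite <- HEL. split; [|now apply exp_increasing].
    destruct Hq as [[Hq| ->] _]; [left; now apply exp_increasing|lra]. }
  (* The reciprocal of the threshold in [bad_size]. *)
  set (Y := exp (INR q) * psi q / (2 * INR P)).
  assert (HepP : 0 < exp (INR q) * psi q) by now apply Rmult_lt_0_compat.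
  assert (HYpos : 0 < Y) by (apply Rdiv_lt_0_compat; lra).
  assert (HY : forall k, (k < n)%nat -> 0 < orb k x /\ / orb k x <= Y).
  { intros k Hk. assert (Hy : / Y <= orb k x).
    { apply Rnot_lt_le. intros H. apply (HM2 q); [tauto|]. split; [assumption|].
      exists k. split.
      - apply lt_INR in Hk. lra.
      - replace (2 * INR P / (exp (INR q) * psi q)) with (/ Y) by (unfold Y; field; lra).
        assumption. }
    assert (HiY : 0 < / Y) by now apply Rinv_0_lt_compat.
    split; [lra|]. rewrite <- (Rinv_inv Y). apply Rinv_le_contravar; lra. }
  split; [apply trimmed_sum_val; intros; now apply HY|].
  assert (HB : INR b <= eta * Rpower L (1 / 4)).
  { assert (Hr : 0 < Rpower L (1 / 4)) by apply exp_pos.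
    specialize (HM3 n ltac:(lia)). unfold Rdist in HM3. fold L in HM3.
    rewrite Rminus_0_r in HM3. apply Rabs_def2 in HM3. destruct HM3 as [HM3 _].
    apply Rmult_lt_compat_r with (r := Rpower L (1 / 4)) in HM3; [|assumption].
    unfold Rdiv in HM3. rewrite Rmult_assoc, Rinv_l, Rmult_1_r in HM3 by lra.
    unfold b. destruct (Z_le_gt_dec 0 (bseq psi n)) as [Hz|Hz].
    - rewrite INR_IZR_INZ, Z2Nat.id by assumption. lra.
    - replace (Z.to_nat (bseq psi n)) with O by lia. simpl. nra. }
  apply (block_estimate P m i n b x L Y); fold e; auto.
  - apply HM1. lia.
  - lra.
  (* The choice of [b_n] enters here: [psi q / 2 <= L * 2 ^ b] and [exp q <= n] together give
     [Y * P <= n L 2^b]. *)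
  - pose proof (pow2_pos b) as Hpb. rewrite pow_inv.
    apply Rmult_le_reg_l with (2 ^ b); [lra|].
    rewrite <- Rmult_assoc, Rinv_r, Rmult_1_l by lra.
    apply Rmult_le_reg_r with (INR P); [lra|].
    replace (Y * INR P) with (exp (INR q) * (psi q / 2)) by (unfold Y; field; lra).
    replace (2 ^ b * (e * (INR n * L)) * INR P) with (e * INR P * (INR n * (L * 2 ^ b))) by ring.
    rewrite HeP, Rmult_1_l. apply Rmult_le_compat; lra.
  - split; [|assumption].
    assert (ln (INR P) + 1 <= e * L).
    { apply Rmult_le_reg_l with (INR P); [lra|].
      replace (INR P * (e * L)) with (e * INR P * L) by ring. rewrite HeP. lra. }
    lra.
  - assert (Hht := ht_small P m ltac:(lia) ltac:(lra)).
    rewrite plus_INR.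
    assert (Hh2 : INR (ht m) <= e * INR m / 2).
    { replace (e * INR m / 2) with (INR m / (2 * INR P)) by (unfold e; field; lra). lra. }
    assert (HP3 : INR P + 3 <= e * INR m / 2).
    { apply Rmult_le_reg_l with (INR P); [lra|].
      replace (INR P * (e * INR m / 2)) with (e * INR P * INR m / 2) by field.
      rewrite HeP. lra. }
    pose proof (pos_INR (ht m)). nra.
  - pose proof (trimming_negligible P m b L ltac:(lia) ltac:(lia) HL HmL HB) as H.
    fold e in H. rewrite !pow_add.
    apply Rle_trans with (2 ^ m * (e * L)).
    + replace (INR b * (2 ^ m * 2 ^ ht m * 2 ^ P)) with (2 ^ m * (INR b * 2 ^ ht m * 2 ^ P)) by ring.
      apply Rmult_le_compat_l; lra.
    + replace (e * (INR n * L)) with (INR n * (e * L)) by ring.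
      apply Rmult_le_compat_r; nra.
  - apply Rmult_le_reg_l with (INR P); [lra|].
    replace (INR P * (e * L)) with (e * INR P * L) by ring. rewrite HeP. lra.
Qed.

Theorem theorem1p1 (psi : nat -> R) :
  in_Psi psi ->
  Un_cv (fun n => IZR (bseq psi n) / Rpower (ln (INR n)) (1 / 4)) 0 ->
  lebesgue_null (fun x =>
    0 <= x < 1 /\
    ~ ext_cv (fun n => trimmed_sum n (Z.to_nat (bseq psi n)) x)
             (fun n => INR n * ln (INR n)) 1).
Proof.
  intros Hpsi Hb. apply lebesgue_null_outer. intros eps Heps.
  (* The accuracy parameter is [P = p + 2], so that [P >= 2]; off the countable union over [p] every
     relative error [20 / P] is eventually attained. *)
  apply outer_le_weaken with
    (E := fun x => exists p,
       (forall M, exists m, (M <= m)%nat /\ bad_block (S (S p)) m x) \/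
       (forall M, exists q, (M <= q)%nat /\ bad_size psi (S (S p)) q x)) (p := eps).
  - intros x [Hx Hcv]. apply NNPP. intros Hgood. apply Hcv.
    assert (Hclose : forall p, exists n0, forall n, (n0 <= n)%nat ->
      0 < INR n * ln (INR n) /\
      trimmed_sum n (Z.to_nat (bseq psi n)) x <> None /\
      Rabs (ext_val (trimmed_sum n (Z.to_nat (bseq psi n)) x) - INR n * ln (INR n))
        <= 20 * / INR (S (S p)) * (INR n * ln (INR n))).
    { intros p. apply trimmed_sum_close; auto with arith.
      - apply NNPP. intros H. apply Hgood. exists p. left. intros M. apply NNPP.
        intros H'. apply H. exists M. intros m Hm Hbad. apply H'. eauto.
      - apply NNPP. intros H. apply Hgood. exists p. right. intros M. apply NNPP.
        intros H'. apply H. exists M. intros m Hm Hbad. apply H'. eauto. }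
    split.
    + destruct (Hclose O) as [n0 H]. exists n0. intros n Hn. now apply H.
    + intros d Hd. destruct (INR_unbounded (20 / d)) as [p Hp].
      destruct (Hclose p) as [n0 H]. exists n0. intros n Hn.
      destruct (H n Hn) as (HNL & _ & Hc). unfold Rdist.
      set (S0 := ext_val _) in *. set (c := INR n * ln (INR n)) in *.
      replace (S0 / c - 1) with ((S0 - c) / c) by (field; lra).
      unfold Rdiv. rewrite Rabs_mult, (Rabs_right (/ c))
        by (left; now apply Rinv_0_lt_compat).
      apply Rle_lt_trans with (20 * / INR (S (S p))).
      * apply Rmult_le_reg_r with c; [assumption|].
        rewrite Rmult_assoc, Rinv_l by lra. lra.
      * assert (HpS : 20 / d < INR (S (S p))) by (rewrite !S_INR; lra).
        assert (0 < 20 / d) by (apply Rdiv_lt_0_compat; lra).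
        apply Rmult_lt_reg_r with (INR (S (S p))); [lra|].
        rewrite Rmult_assoc, Rinv_l by lra.
        apply Rmult_lt_compat_l with (r := d) in HpS; [|lra].
        replace (d * (20 / d)) with 20 in HpS by (field; lra). lra.
  - lra.
  - apply (null_countable_union (fun p x =>
       (forall M, exists m, (M <= m)%nat /\ bad_block (S (S p)) m x) \/
       (forall M, exists q, (M <= q)%nat /\ bad_size psi (S (S p)) q x))); [|assumption].
    intros p. apply null_union; [apply null_bad_block; lia|now apply null_bad_size].
Qed.
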